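(* Let $n\ge2$ and let $M^n$ be one of $\mathbb{S}^n,\mathbb{P}^n(\mathbb{R}),\mathbb{P}^n(\mathbb{C}),\mathbb{P}^n(\mathbb{H})$, with the associated objects $I_{M^n}$, $\mu_n$, $\tilde\mu_n$, $\Lambda_n$, $G_n$, $\varphi_k$, $\lambda_k$ defined in the context. The family $\{\Lambda_n\varphi_k:\ k\ge1\}$ is an orthogonal complete system of functions in $L^2([0,\pi],\mu_n)$, where $\mu_n$ is the invariant measure of $L_n$. Also the functions $$\widetilde{\Lambda_n\varphi_k}:=\frac{\Lambda_n\varphi_k}{\|\Lambda_n\varphi_k\|_{L^2([0,\pi],\mu_n)}},\qquad k\ge1,$$ form a Hilbert basis of eigenfunctions of $G_n$ associated respectively to the eigenvalues $\frac{-1}{\lambda_k}$, where for $k\ge1$ $$\|\Lambda_n\varphi_k\|^2_{L^2([0,\pi],\mu_n)}=-\frac1{\lambda_k}\|\varphi_k\|^2_{L^2([0,\pi],\tilde\mu_n)}.$$ Moreover, for all $g\in L^2([0,\pi],\mu_n)$ and all integers $m\ge0$, $$G_n^{\circ m}(g)=\sum_{k=1}^{\infty}\Big(-\frac1{\lambda_k}\Big)^m\frac{1}{\|\Lambda_n\varphi_k\|^2_{L^2([0,\pi],\mu_n)}}\,\Lambda_n\varphi_k\,\langle\Lambda_n\varphi_k,g\rangle_{L^2([0,\pi],\mu_n)}.$$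
   Context: $M^n$ has real dimension $n$ ($n\ge 2$ for $\mathbb{S}^n$ and $\mathbb{P}^n(\mathbb{R})$; $n=4,6,8,\dots$ for $\mathbb{P}^n(\mathbb{C})$; $n=8,12,16,\dots$ for $\mathbb{P}^n(\mathbb{H})$) and its canonical metric is normalized to have diameter $\pi$. Define (up to an irrelevant multiplicative constant) $I'_{M^n}$ on $[0,\pi]$ and $\alpha,\beta,\gamma$ by: - $\mathbb{S}^n$: $I'_{M^n}(r)=\sin^{n-1}(r)$, $\alpha=\beta=\frac{n-2}2$, $\gamma=1$; - $\mathbb{P}^n(\mathbb{R})$: $I'_{M^n}(r)=\sin^{n-1}(r/2)$, $\alpha=\beta=\frac{n-2}2$, $\gamma=\frac12$; - $\mathbb{P}^n(\mathbb{C})$: $I'_{M^n}(r)=\sin(r)\sin^{n-2}(r/2)$, $\alpha=\frac{n-2}2,\beta=0$, $\gamma=1$; - $\mathbb{P}^n(\mathbb{H})$: $I'_{M^n}(r)=\sin^3(r)\sin^{n-4}(r/2)$, $\alpha=\frac{n-2}2,\beta=1$, $\gamma=1$. Let $I_{M^n}(r)=\int_0^rI'_{M^n}(s)\,ds$. The radial Laplacian is $\Delta_n=\partial_r^2+(\ln I'_{M^n}(r))'\partial_r$, with invariant measure $\tilde\mu_n(dr)=I'_{M^n}(r)dr$ on $[0,\pi]$. The operator $L_n=\partial_r^2+b_n(r)\partial_r$, $b_n=\frac{d}{dr}\ln\big(I_{M^n}^2/I'_{M^n}\big)$, has invariant measure $\mu_n(dr)=\frac{I_{M^n}^2(r)}{I'_{M^n}(r)}dr$.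 The link is $\Lambda_nF(r)=\frac{1}{I_{M^n}(r)}\int_0^rF(s)I'_{M^n}(s)\,ds$. The Green operator is $$G_n[g](r)=\int_r^\pi\frac{I'_{M^n}(t)}{I_{M^n}^2(t)}\Big(\int_0^t\frac{I_{M^n}^2(s)}{I'_{M^n}(s)}g(s)\,ds\Big)dt,$$ equivalently $G_n[g](r)=\int_0^\pi k_n(r,s)g(s)\mu_n(ds)$ with $k_n(r,s)=\int_{\max(r,s)}^\pi\frac{I'_{M^n}(t)}{I_{M^n}^2(t)}dt$, and $G_n^{\circ m}$ is its $m$-fold iterate. For $k\ge0$, $\varphi_k(r)=P_k^{\alpha,\beta}(\cos(\gamma r))$ if $M^n\ne\mathbb{P}^n(\mathbb{R})$ and $\varphi_k(r)=P_{2k}^{\alpha,\alpha}(\cos(\gamma r))$ if $M^n=\mathbb{P}^n(\mathbb{R})$, where $P_k^{\alpha,\beta}$ are the Jacobi polynomials ($P_k^{\alpha,\beta}(1)=\frac{\Gamma(k+\alpha+1)}{k!\Gamma(\alpha+1)}$); these form a complete orthogonal system of eigenfunctions of $\Delta_n$ in $L^2([0,\pi],\tilde\mu_n)$ with eigenvalues $\lambda_k=-k(k+\alpha+\beta+1)$ if $M^n\neq\mathbb{P}^n(\mathbb{R})$ and $\lambda_k=-k(k+\frac{n-1}2)$ if $M^n=\mathbb{P}^n(\mathbb{R})$. *)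

(* Defs.v *)
From HB Require Import structures.
From mathcomp Require Import all_boot all_order all_algebra.
From mathcomp Require Import all_classical all_reals all_analysis.
From mathcomp Require Import measurable_realfun.

Set Implicit Arguments.
Unset Strict Implicit.
Unset Printing Implicit Defensive.
Import Order.TTheory GRing.Theory Num.Theory.
Import numFieldNormedType.Exports.

Local Open Scope classical_set_scope.
Local Open Scope ring_scope.

Section L2.
Context d (T : measurableType d) (R : realType).
Variable mu : {measure set T -> \bar R}.
Implicit Types (f g : T -> R) (u e : nat -> T -> R).

Definition L2dot f g : R := \int[mu]_x (f x * g x).

Definition L2norm f : R := fine ('N[mu]_2%:E[EFin \o f])%E.

Definition orthogonal_system e : Prop :=
  [/\ forall k, e k \in Lfun mu 2%:E,
      forall k, L2norm (e k) != 0
    & forall j k, j != k -> L2dot (e j) (e k) = 0].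

(* The finite linear combinations of the [e k] are dense in L^2(mu). *)
Definition complete_system e : Prop :=
  forall g, g \in Lfun mu 2%:E -> forall eps : R, 0 < eps ->
  exists (N : nat) (c : nat -> R),
    ('N[mu]_2%:E[EFin \o (fun x => g x - \sum_(k < N) c k * e k x)%R]
       < eps%:E)%E.

Definition hilbert_basis e : Prop :=
  [/\ orthogonal_system e, complete_system e & forall k, L2norm (e k) = 1].

Definition L2_cvg u f : Prop :=
  f \in Lfun mu 2%:E /\
  ('N[mu]_2%:E[EFin \o (fun x => u N x - f x)%R]%E @[N --> \oo] --> 0%E).

Definition eigenfunction (A : (T -> R) -> (T -> R)) (c : R) f : Prop :=
  [/\ f \in Lfun mu 2%:E, ~ (f = (fun=> 0) %[ae mu])
    & A f = (fun x => c * f x) %[ae mu]].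

End L2.

(* The hypergeometric form of the Jacobi polynomials:
   sum_s (k+a+b+1)_s (a+s+1)_(k-s) / (s! (k-s)!) ((x-1)/2)^s,
   with (y)_s the rising factorial. *)
Definition jacobi (R : realType) (a b : R) (k : nat) : {poly R} :=
  \sum_(s < k.+1)
    ((\prod_(0 <= i < s) (k%:R + a + b + 1 + i%:R)) *
     (\prod_(s <= i < k) (a + 1 + i%:R)) / (s`! * (k - s)`!)%:R)
      *: (2^-1 *: ('X - 1)) ^+ s.

(* The value at 1 is Gamma(k+a+1) / (k! Gamma(a+1)). *)
Lemma jacobi_at1 (R : realType) (a b : R) (k : nat) :
  (jacobi a b k).[1] = \prod_(0 <= i < k) (a + 1 + i%:R) / k`!%:R.
Proof.
rewrite /jacobi horner_sum big_ord_recl /= [X in _ + X]big1 ?addr0.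
  rewrite expr0 hornerZ hornerC mulr1 [X in X * _ / _]big_geq// mul1r.
  by rewrite fact0 mul1n subn0.
move=> s _; rewrite hornerZ horner_exp hornerZ !hornerE subrr mulr0.
by rewrite expr0n /= mulr0.
Qed.

(* S^n, P^n(R), P^n(C), P^n(H); the parameter n is always the real dimension. *)
Variant crossSpace := Sphere | RealProj | ComplexProj | QuaternionProj.

Definition valid_dim (M : crossSpace) (n : nat) : bool :=
  match M with
  | Sphere | RealProj => (2 <= n)%N
  | ComplexProj => (4 <= n)%N && (2 %| n)%N
  | QuaternionProj => (8 <= n)%N && (4 %| n)%N
  end.

Section Objects.
Variables (R : realType) (M : crossSpace) (n : nat).

Local Notation leb := (@lebesgue_measure R).

(* I'_M *)
Definition dvol (r : R) : R :=
  match M with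
  | Sphere => sin r ^+ (n - 1)
  | RealProj => sin (r / 2) ^+ (n - 1)
  | ComplexProj => sin r * sin (r / 2) ^+ (n - 2)
  | QuaternionProj => sin r ^+ 3 * sin (r / 2) ^+ (n - 4)
  end.

(* I_M *)
Definition vol (r : R) : R := \int[leb]_(s in `[0, r]) dvol s.

Definition jalpha : R := (n%:R - 2) / 2.

Definition jbeta : R :=
  match M with
  | Sphere | RealProj => (n%:R - 2) / 2
  | ComplexProj => 0
  | QuaternionProj => 1
  end.

Definition jgamma : R := match M with RealProj => 2^-1 | _ => 1 end.

Definition phi (k : nat) (r : R) : R :=
  match M with
  | RealProj => (jacobi jalpha jalpha (2 * k)%N).[cos (jgamma * r)]
  | _ => (jacobi jalpha jbeta k).[cos (jgamma * r)]
  end.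

Definition eigval (k : nat) : R :=
  match M with
  | RealProj => - (k%:R * (k%:R + (n%:R - 1) / 2))
  | _ => - (k%:R * (k%:R + jalpha + jbeta + 1))
  end.

(* The invariant measures are measures on R carried by [0, pi], so that
   L^2([0, pi], mu) is the L^2 space of the measure. *)
Definition inv_measure_Delta (A : set (measurableTypeR R)) : \bar R :=
  (\int[leb]_(r in `[0%R, pi] `&` A) (dvol r)%:E)%E.

Definition inv_measure_L (A : set (measurableTypeR R)) : \bar R :=
  (\int[leb]_(r in `[0%R, pi] `&` A) (vol r ^+ 2 / dvol r)%:E)%E.

Definition link (F : R -> R) (r : R) : R :=
  (vol r)^-1 * \int[leb]_(s in `[0, r]) (F s * dvol s).

Definition green (g : R -> R) (r : R) : R :=
  \int[leb]_(t in `[r, pi])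
    (dvol t / vol t ^+ 2 *
     \int[leb]_(s in `[0, t]) (vol s ^+ 2 / dvol s * g s)).

Definition link_phi (k : nat) : R -> R := link (phi k).

Lemma dvol_ge0 r : `[0, pi]%classic r -> 0 <= dvol r.
Proof.
rewrite /= in_itv /= => /andP[r0 rpi].
have s1 : 0 <= sin r by apply: sin_ge0_pi; rewrite r0.
have s2 : 0 <= sin (r / 2).
  apply: sin_ge0_pi; rewrite divr_ge0//=.
  by rewrite (le_trans _ rpi)// ler_pdivrMr// ler_peMr// ler1n.
by rewrite /dvol; case: M; rewrite ?mulr_ge0// exprn_ge0.
Qed.

Lemma continuous_dvol : continuous dvol.
Proof.
have cs (m : nat) : continuous (fun r : R => sin r ^+ m).
  move=> r; apply: (@continuous_comp _ _ _ sin (fun x => x ^+ m)).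
    exact: continuous_sin.
  exact: exprn_continuous.
have ch (m : nat) : continuous (fun r : R => sin (r / 2) ^+ m).
  move=> r; apply: (@continuous_comp _ _ _ (fun r : R => r / 2)
                      (fun r : R => sin r ^+ m)); last exact: cs.
  exact: mulrr_continuous.
rewrite /dvol; case: M => //= r; apply: cvgM.
- exact: continuous_sin.
- exact: ch.
- exact: cs.
- exact: ch.
Qed.

Lemma measurable_dvol : measurable_fun (`[0, pi] : set R) dvol.
Proof.
apply: subspace_continuous_measurable_fun => //.
by apply: continuous_subspaceT; exact: continuous_dvol.
Qed.

Lemma measurable_vol : measurable_fun (`[0, pi] : set R) vol.
Proof.
apply: subspace_continuous_measurable_fun => //.
apply: parameterized_integral_continuous; first exact: pi_ge0.
apply: continuous_compact_integrable; first exact: segment_compact.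
by apply: continuous_subspaceT; exact: continuous_dvol.
Qed.

Lemma measurable_density_L :
  measurable_fun (`[0, pi] : set R) (fun r => vol r ^+ 2 / dvol r).
Proof.
apply: (eq_measurable_fun (fun r => vol r ^+ 2 * dvol r `^ (- 1))).
  by move=> r; rewrite inE => rpi; rewrite powR_inv1// dvol_ge0.
apply: measurable_funM.
  by apply: measurable_funX; exact: measurable_vol.
have m1 : measurable_fun [set: R] (fun x : R => x `^ (- 1)).
  exact: measurable_powR.
exact: (measurableT_comp m1 measurable_dvol).
Qed.

Lemma density_L_ge0 r : `[0, pi]%classic r -> 0 <= vol r ^+ 2 / dvol r.
Proof. by move=> rpi; rewrite divr_ge0 ?sqr_ge0// dvol_ge0. Qed.

End Objects.

Section Density.
Variables (R : realType) (w : R -> R).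
Hypotheses (mw : measurable_fun (`[0, pi] : set R) w)
  (w0 : forall r, `[0, pi]%classic r -> 0 <= w r).

Let nu (A : set (measurableTypeR R)) : \bar R :=
  (\int[@lebesgue_measure R]_(r in `[0%R, pi] `&` A) (w r)%:E)%E.

Lemma density0 : nu set0 = 0%E.
Proof. by rewrite /nu setI0 integral_set0. Qed.

Lemma density_ge0 A : (0 <= nu A)%E.
Proof. by apply: integral_ge0 => r [rpi _]; rewrite lee_fin w0. Qed.

Lemma density_sigma_additive : semi_sigma_additive nu.
Proof.
have -> : nu = (fun A => \int[@lebesgue_measure R]_(r in A)
                  ((EFin \o w) \_ `[0%R, pi]) r)%E.
  by apply/funext => A; rewrite /nu setIC integral_mkcondr.
apply: semi_sigma_additive_nng_induced.
  by apply/(measurable_restrictT _ _).1 => //; exact/measurable_EFinP.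
by apply: erestrict_ge0 => r rpi; rewrite lee_fin w0.
Qed.

End Density.

HB.instance Definition _ (R : realType) (M : crossSpace) (n : nat) :=
  isMeasure.Build _ _ _ (@inv_measure_Delta R M n)
    (density0 _) (density_ge0 (@dvol_ge0 R M n))
    (density_sigma_additive (@measurable_dvol R M n) (@dvol_ge0 R M n)).

HB.instance Definition _ (R : realType) (M : crossSpace) (n : nat) :=
  isMeasure.Build _ _ _ (@inv_measure_L R M n)
    (density0 _) (density_ge0 (@density_L_ge0 R M n))
    (density_sigma_additive (@measurable_density_L R M n)
       (@density_L_ge0 R M n)).

(* Main.v *)
From HB Require Import structures.
Require Import Defs.
From mathcomp Require Import all_boot all_order all_algebra.
From mathcomp Require Import all_classical all_reals all_analysis.
From mathcomp Require Import measurable_realfun polyorder ring lra.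
Import Order.TTheory GRing.Theory Num.Theory.
Import numFieldNormedType.Exports.

Set Implicit Arguments.
Unset Strict Implicit.
Unset Printing Implicit Defensive.

Local Open Scope classical_set_scope.
Local Open Scope ring_scope.

(** Write [w] for the density of the radial volume, [v] for its primitive
    vanishing at [0], and [x = cos r]. In the four geometries [w] is, up to a
    constant, [(1 - x) ^ a (1 + x) ^ b sin r], which is used only through the
    polynomial form of its logarithmic derivative ([is_derive_dvol]); on the
    real projective space a quadratic transformation of Jacobi polynomials
    ([jacobi_quadratic]) brings [phi k] to this form with [b = -1/2]. The Jacobi
    equation then says that [flux k := w * phi_k'] has derivative
    [lambda_k * w * phi_k] ([is_derive_flux]).

    Integrating, the link transform of [phi k] is [w / v * phi_k' / lambda_k]
    ([link_phiE]). Multiplication by [w / v] is an isometry of [L^2(w)] onto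
    [L^2(v ^ 2 / w)], so the first claims concern the derivatives [phi_k'] in
    [L^2(w)]. Green's formula ([dirichlet_form]) gives their orthogonality and
    their norms. As [phi_k'] is [- sin r] times a polynomial of degree [k - 1]
    in [cos r], completeness amounts to the density of the functions
    [sin r * Q (cos r)], which follows from the Weierstrass theorem after a
    truncation ([complete_link_phi]).

    Differentiating [v * phi_k - flux_k / lambda_k] and [flux_k / v] shows that
    the two integrations in the Green operator send the link transform [psi_k]
    of [phi k] to [- psi_k / lambda_k] ([green_link_phi]). To pass from finite
    combinations to all of [L^2] it remains to bound the operator. No estimate
    of its kernel is needed: the kernel is nonnegative and symmetric and has
    the eigenfunction [psi_1] of constant sign, so the Schur test ([schur_test]) bounds its
    norm by [- 1 / lambda_1] ([green_bounded]). A bounded operator that is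
    diagonal on a complete orthogonal system has the stated expansions
    ([spectral_expansion]). *)

(** * The Hilbert space of square integrable functions *)

Section L2_space.
Context d (T : measurableType d) (R : realType).
Variable mu : {measure set T -> \bar R}.
Implicit Types (f g h : T -> R) (e : nat -> T -> R).

Local Notation L2 := (Lfun mu 2%:E).

Lemma Lnorm2_sq f : (('N[mu]_2%:E[EFin \o f]) `^ 2 =
  \int[mu]_x (f x ^+ 2)%:E)%E.
Proof.
rewrite poweR_Lnorm//; apply: eq_integral => x _ /=.
by rewrite powR_mulrn ?real_normK ?num_real//.
Qed.

Lemma in_L2P f : f \in L2 <->
  measurable_fun [set: T] f /\ (\int[mu]_x (f x ^+ 2)%:E < +oo)%E.
Proof.
rewrite inE; split => [/andP[/[!inE] mf fin]|[mf fin]].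
  split => //; rewrite -Lnorm2_sq poweR_lty//.
apply/andP; rewrite !inE; split => //=; rewrite /finite_norm.
apply: (@lty_poweRy _ _ 2) => //; by rewrite Lnorm2_sq.
Qed.

Lemma L2_measurable f : f \in L2 -> measurable_fun [set: T] f.
Proof. by case/in_L2P. Qed.

Lemma L2_lin a f g : f \in L2 -> g \in L2 -> (fun x => f x + a * g x) \in L2.
Proof.
move=> fL gL; have : a *: g + f \in L2.
  by apply: (proj2 (Lfun_submod_closed mu (lee1n 2))).
by rewrite addrC.
Qed.

Lemma L2_0 : (fun=> 0) \in L2.
Proof. exact: (proj1 (Lfun_submod_closed mu (lee1n 2))). Qed.

Lemma L2_add f g : f \in L2 -> g \in L2 -> (fun x => f x + g x) \in L2.
Proof.
move=> fL gL; have := L2_lin 1 fL gL.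
by under eq_fun do rewrite mul1r.
Qed.

Lemma L2_sub f g : f \in L2 -> g \in L2 -> (fun x => f x - g x) \in L2.
Proof.
move=> fL gL; have := L2_lin (-1) fL gL.
by under eq_fun do rewrite mulN1r.
Qed.

Lemma L2_scale a f : f \in L2 -> (fun x => a * f x) \in L2.
Proof.
move=> fL; have := L2_lin a L2_0 fL.
by under eq_fun do rewrite add0r.
Qed.

Lemma L2_sum N (c : nat -> R) e : (forall k, e k \in L2) ->
  (fun x => \sum_(k < N) c k * e k x) \in L2.
Proof.
move=> eL; elim: N => [|N IH].
  by under eq_fun do rewrite big_ord0; exact: L2_0.
by under eq_fun do rewrite big_ord_recr; exact: L2_lin.
Qed.

Lemma L2_mul_integrable f g : f \in L2 -> g \in L2 ->
  mu.-integrable [set: T] (EFin \o (fun x => f x * g x)).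
Proof. by move=> fL gL; apply/Lfun1_integrable/Lfun2_mul_Lfun1. Qed.

Lemma L2normE f : f \in L2 -> ('N[mu]_2%:E[EFin \o f] = (L2norm mu f)%:E)%E.
Proof.
move=> fL; rewrite fineK// fin_numElt (lt_le_trans ltNy0) ?Lnorm_ge0//=.
by move: fL; rewrite inE => /andP[_]; rewrite inE.
Qed.

Lemma L2norm_ge0 f : 0 <= L2norm mu f.
Proof. by rewrite fine_ge0// Lnorm_ge0. Qed.

Lemma EFin_L2norm_sq f : f \in L2 ->
  ((L2norm mu f ^+ 2)%:E = \int[mu]_x (f x ^+ 2)%:E)%E.
Proof.
by move=> fL; rewrite -Lnorm2_sq L2normE// poweR_EFin powR_mulrn// L2norm_ge0.
Qed.

Lemma L2norm_sq f : f \in L2 -> L2norm mu f ^+ 2 = L2dot mu f f.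
Proof.
move=> fL; rewrite /L2dot /Rintegral.
by under eq_integral do rewrite -expr2; rewrite -EFin_L2norm_sq.
Qed.

Lemma L2dotC f g : L2dot mu f g = L2dot mu g f.
Proof. by rewrite /L2dot; under eq_Rintegral do rewrite mulrC. Qed.

Lemma L2dot_linr a f g h : f \in L2 -> g \in L2 -> h \in L2 ->
  L2dot mu h (fun x => f x + a * g x) = L2dot mu h f + a * L2dot mu h g.
Proof.
move=> fL gL hL; rewrite /L2dot -RintegralZl//; last exact: L2_mul_integrable.
rewrite -RintegralD//.
- by apply: eq_Rintegral => x _; rewrite mulrDr mulrCA.
- exact: L2_mul_integrable.
- have := L2_mul_integrable hL (L2_scale a gL).
  by congr (integrable _ _ _); apply/funext => x /=; rewrite mulrCA.
Qed.

Lemma L2dot0r h : h \in L2 -> L2dot mu h (fun=> 0) = 0.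
Proof.
move=> hL; have := L2dot_linr (-1) L2_0 L2_0 hL.
by under [X in L2dot _ _ X]eq_fun do rewrite add0r mulr0; move=> ->; ring.
Qed.

Lemma L2dot_Zr a g h : g \in L2 -> h \in L2 ->
  L2dot mu h (fun x => a * g x) = a * L2dot mu h g.
Proof.
move=> gL hL; have := L2dot_linr a L2_0 gL hL.
under [X in L2dot _ _ X]eq_fun do rewrite add0r.
by rewrite L2dot0r// add0r.
Qed.

Lemma L2dot_sumr N (c : nat -> R) e h : (forall k, e k \in L2) -> h \in L2 ->
  L2dot mu h (fun x => \sum_(k < N) c k * e k x) =
  \sum_(k < N) c k * L2dot mu h (e k).
Proof.
move=> eL hL; elim: N => [|N IH].
  by rewrite big_ord0; under [X in L2dot _ _ X]eq_fun do rewrite big_ord0;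
    exact: L2dot0r.
under [X in L2dot _ _ X]eq_fun do rewrite big_ord_recr /=.
by rewrite L2dot_linr//; [rewrite IH big_ord_recr|exact: L2_sum].
Qed.

Lemma L2norm_scale a f : f \in L2 ->
  L2norm mu (fun x => a * f x) = `|a| * L2norm mu f.
Proof.
move=> fL; have aL := L2_scale a fL.
apply/eqP; rewrite -(@eqrXn2 _ 2) ?mulr_ge0 ?L2norm_ge0//.
rewrite exprMn real_normK ?num_real// !L2norm_sq// L2dot_Zr//.
by rewrite L2dotC L2dot_Zr// mulrA expr2.
Qed.

Lemma L2norm0 : L2norm mu (fun=> 0) = 0.
Proof. by apply/eqP; rewrite -sqrf_eq0 L2norm_sq ?L2_0// L2dot0r ?L2_0. Qed.

Lemma L2norm_ae f g : f \in L2 -> g \in L2 -> f = g %[ae mu] ->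
  L2norm mu f = L2norm mu g.
Proof.
move=> fL gL fg; apply/eqP; rewrite -(@eqrXn2 _ 2) ?L2norm_ge0// !L2norm_sq//.
apply/eqP; congr fine; apply: ae_eq_integral => //.
- by apply/measurable_EFinP/measurable_funM; exact: L2_measurable.
- by apply/measurable_EFinP/measurable_funM; exact: L2_measurable.
- by apply: filterS fg => x /= fg xT; rewrite fg.
Qed.

Section orthogonal_expansion.
Variable e : nat -> T -> R.
Hypotheses (oe : orthogonal_system mu e) (ce : complete_system mu e).

Definition fourier_sum g N x :=
  \sum_(k < N) (L2dot mu (e k) g / L2norm mu (e k) ^+ 2) * e k x.

Let eL k : e k \in L2. Proof. by case: oe. Qed.

Lemma fourier_sum_L2 g N : fourier_sum g N \in L2.
Proof. exact: (L2_sum N (fun k => L2dot mu (e k) g / L2norm mu (e k) ^+ 2)). Qed.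

Let L2dot_remainder g N (j : 'I_N) : g \in L2 ->
  L2dot mu (fun x => g x - fourier_sum g N x) (e j) = 0.
Proof.
move=> gL; rewrite L2dotC.
under [X in L2dot _ _ X]eq_fun do rewrite -mulN1r.
rewrite L2dot_linr ?fourier_sum_L2//.
rewrite (L2dot_sumr N (fun k => L2dot mu (e k) g / L2norm mu (e k) ^+ 2))//.
rewrite (bigD1 j)//= big1 => [|k kj].
  rewrite addr0 -L2norm_sq// divfK ?mulN1r ?subrr//.
  by rewrite sqrf_eq0; case: oe.
by case: oe => _ _ ->; rewrite ?mulr0// eq_sym.
Qed.

(** The remainder [g - fourier_sum g N] is orthogonal to the first [N] vectors,
    so Pythagoras' theorem applies to its sum with any combination of them. *)
Lemma fourier_sum_best g N (c : nat -> R) : g \in L2 ->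
  L2norm mu (fun x => g x - fourier_sum g N x) <=
  L2norm mu (fun x => g x - \sum_(k < N) c k * e k x).
Proof.
move=> gL; pose b k := L2dot mu (e k) g / L2norm mu (e k) ^+ 2 - c k.
pose h x := g x - fourier_sum g N x.
pose s x := \sum_(k < N) b k * e k x.
have hL : h \in L2 by apply: L2_sub => //; exact: fourier_sum_L2.
have sL : s \in L2 by exact: L2_sum.
have -> : (fun x => g x - \sum_(k < N) c k * e k x) = (fun x => h x + 1 * s x).
  apply/funext => x; rewrite /h /s /fourier_sum mul1r.
  under [X in _ = _ - _ + X]eq_bigr do rewrite mulrBl.
  by rewrite sumrB; ring.
rewrite -(@ler_pXn2r _ 2) ?nnegrE ?L2norm_ge0//.
rewrite !L2norm_sq//; last exact: L2_lin.
rewrite L2dot_linr//; last exact: L2_lin.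
rewrite L2dotC [X in _ + 1 * X]L2dotC !L2dot_linr//.
have -> : L2dot mu h s = 0.
  by rewrite L2dot_sumr// big1// => k _; rewrite L2dot_remainder ?mulr0.
rewrite (L2dotC s h) L2dot_sumr// big1 => [|k _]; last first.
  by rewrite L2dot_remainder ?mulr0.
by rewrite !mulr0 !mul1r !addr0 !add0r lerDl -L2norm_sq// sqr_ge0.
Qed.

Lemma fourier_sum_cvg g : g \in L2 ->
  L2norm mu (fun x => g x - fourier_sum g N x) @[N --> \oo] --> 0.
Proof.
move=> gL; apply/cvgrPdist_lt => eps eps0.
have [N [c]] := ce gL eps0.
rewrite L2normE; last by apply: L2_sub => //; exact: L2_sum.
rewrite lte_fin => lt_eps; near=> K.
rewrite sub0r normrN ger0_norm ?L2norm_ge0//.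
apply: le_lt_trans lt_eps.
have NK : (N <= K)%N by near: K; exists N.
apply: le_trans (fourier_sum_best K (fun k => if (k < N)%N then c k else 0) gL) _.
rewrite le_eqVlt; apply/orP; left; apply/eqP; congr L2norm; apply/funext => x.
rewrite (big_ord_widen _ (fun k => c k * e k x) NK) [in RHS]big_mkcond/=.
by congr (_ - _); apply: eq_bigr => k _; case: ifP; rewrite ?mul0r.
Unshelve. all: by end_near. Qed.

(** On Fourier sums the operator acts term by term; boundedness allows to pass
    to the limit. Linearity is only required almost everywhere, as an integral
    operator need not converge at every point. *)
Lemma spectral_expansion (A : (T -> R) -> T -> R) (c : R) (l : nat -> R) :
    (forall f, f \in L2 -> A f \in L2) ->
    (forall f, f \in L2 -> L2norm mu (A f) <= c * L2norm mu f) ->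
    (forall f g a, f \in L2 -> g \in L2 ->
      A (fun x => f x + a * g x) = (fun x => A f x + a * A g x) %[ae mu]) ->
    (forall k, A (e k) = (fun x => l k * e k x) %[ae mu]) ->
  forall g m, g \in L2 ->
    iter m A g \in L2 /\
    L2norm mu (fun x => \sum_(k < N) l k ^+ m *
        (L2dot mu (e k) g / L2norm mu (e k) ^+ 2) * e k x - iter m A g x)
      @[N --> \oo] --> 0.
Proof.
move=> AL Ab Alin Ae g m gL.
have A0 : A (fun=> 0) = (fun=> 0) %[ae mu].
  have := Alin _ _ (-1) L2_0 L2_0; apply: filterS => x /= + _ => /(_ I).
  under [X in A X x]eq_fun do rewrite mulr0 addr0.
  by move=> ->; ring.
have Asum N (b : nat -> R) : A (fun x => \sum_(k < N) b k * e k x) =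
    (fun x => \sum_(k < N) (l k * b k) * e k x) %[ae mu].
  elim: N => [|N IH].
    under [X in A X]eq_fun do rewrite big_ord0.
    by apply: filterS A0 => x /= + _ => /(_ I) ->; rewrite big_ord0.
  have /= := Alin _ _ (b N) (L2_sum N b eL) (eL N).
  under [X in A X]eq_fun do rewrite -(big_ord_recr N (fun k => b k * e k _)).
  move=> H; apply: filterS3 H IH (Ae N) => x /= + + + _ => /(_ I) -> /(_ I) -> /(_ I) ->.
  by rewrite big_ord_recr/=; ring.
elim: m => [|m [IL IH]].
  split=> //; have := fourier_sum_cvg gL.
  under eq_fun => N.
    have hL := L2_sub gL (fourier_sum_L2 g N).
    rewrite -[L2norm _ _]mul1r -(normr1 R) -normrN -L2norm_scale//.
  over.
  apply: cvg_trans; apply: near_eq_cvg; apply: nearW => N.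
  congr L2norm; apply/funext => x; rewrite /= /fourier_sum.
  by under eq_bigr do rewrite expr0 mul1r; ring.
have IL' := AL _ IL; split=> //=.
have cIH : c * L2norm mu (fun x => \sum_(k < N) l k ^+ m *
        (L2dot mu (e k) g / L2norm mu (e k) ^+ 2) * e k x - iter m A g x)
      @[N --> \oo] --> 0.
  by rewrite -[X in _ --> X](mulr0 c); apply: cvgM; [exact: cvg_cst|exact: IH].
apply: (squeeze_cvgr _ (cvg_cst 0) cIH); near=> N.
rewrite L2norm_ge0/=.
set b := fun k => l k ^+ m * (L2dot mu (e k) g / L2norm mu (e k) ^+ 2).
have uL : (fun x => \sum_(k < N) b k * e k x) \in L2 by exact: L2_sum.
apply: le_trans (Ab _ (L2_sub uL IL)).
rewrite le_eqVlt; apply/orP; left; apply/eqP; apply: L2norm_ae.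
- by apply: L2_sub => //;
    exact: (L2_sum N (fun k => l k ^+ m.+1 * (L2dot mu (e k) g / L2norm mu (e k) ^+ 2))).
- by apply: AL; exact: L2_sub.
have := Alin _ _ (-1) uL IL.
under [X in A X]eq_fun do rewrite mulN1r.
move=> H; apply: filterS2 H (Asum N b) => x /= + + _ => /(_ I) -> /(_ I) ->.
rewrite mulN1r; congr (_ - _); apply: eq_bigr => k _.
by rewrite /b exprS; ring.
Unshelve. all: by end_near. Qed.

End orthogonal_expansion.

End L2_space.

Section normalization.
Context d (T : measurableType d) (R : realType).
Variable mu : {measure set T -> \bar R}.
Variable e : nat -> T -> R.
Hypotheses (oe : orthogonal_system mu e) (ce : complete_system mu e).

Let eL k : e k \in Lfun mu 2%:E. Proof. by case: oe. Qed.
Let e0 k : L2norm mu (e k) != 0. Proof. by case: oe. Qed.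

Let normed k := (fun x => e k x / L2norm mu (e k)).

Let normedE k : normed k = (fun x => (L2norm mu (e k))^-1 * e k x).
Proof. by apply/funext => x; rewrite /normed mulrC. Qed.

Lemma normalized_L2 k : normed k \in Lfun mu 2%:E.
Proof. by rewrite normedE; exact: L2_scale. Qed.

Lemma normalized_norm k : L2norm mu (normed k) = 1.
Proof. by rewrite normedE L2norm_scale// ger0_norm ?invr_ge0 ?L2norm_ge0// mulVf. Qed.

Lemma hilbert_basis_normalized : hilbert_basis mu normed.
Proof.
split; last exact: normalized_norm.
  split=> [k|k|j k jk]; [exact: normalized_L2|by rewrite normalized_norm oner_neq0|].
  rewrite !normedE L2dot_Zr//; last by rewrite -normedE; exact: normalized_L2.
  rewrite L2dotC L2dot_Zr//.
  by case: oe => _ _ -> //; rewrite ?mulr0// eq_sym.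
move=> g gL eps eps0; have [N [c cE]] := ce gL eps0.
exists N, (fun k => c k * L2norm mu (e k)).
move: cE; congr (Lnorm _ _ (EFin \o _) < _)%E; apply/funext => x.
congr (_ - _); apply: eq_bigr => k _.
by rewrite /normed -mulrA (mulrCA (L2norm _ _)) mulfV ?mulr1.
Qed.

End normalization.

(** * Approximation by polynomials in the cosine *)

Section bernstein.
Variable R : realType.
Implicit Types (u v : nat -> R) (f : R -> R) (x : R).

(** [(bernstein n u).[x]] is the expectation of [u] under the binomial law of
    parameters [n] and [x]; conditioning on the first trial gives a recursion in
    which no binomial coefficient appears. *)
Fixpoint bernstein n u : {poly R} :=
  if n is n'.+1 then
    'X * bernstein n' (fun k => u k.+1) + (1 - 'X) * bernstein n' u
  else (u 0%N)%:P.

Lemma bernsteinS n u x : (bernstein n.+1 u).[x] =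
  x * (bernstein n (fun k => u k.+1)).[x] + (1 - x) * (bernstein n u).[x].
Proof. by rewrite /= !hornerE. Qed.

Lemma le_bernstein n u v x : 0 <= x <= 1 -> (forall k, u k <= v k) ->
  (bernstein n u).[x] <= (bernstein n v).[x].
Proof.
move=> /andP[x0 x1]; elim: n u v => [|n IH] u v uv; first by rewrite !hornerE.
rewrite !bernsteinS lerD// ler_wpM2l ?subr_ge0//; exact: IH.
Qed.

Lemma bernstein_quadratic n (a b c : R) x :
  (bernstein n (fun k => a * k%:R ^+ 2 + b * k%:R + c)).[x] =
  a * (n%:R * x * (1 - x) + (n%:R * x) ^+ 2) + b * (n%:R * x) + c.
Proof.
elim: n b c => [|n IH] b c; first by rewrite /= hornerC; ring.
rewrite bernsteinS IH.
have -> : (fun k => a * k.+1%:R ^+ 2 + b * k.+1%:R + c) =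
    (fun k => a * k%:R ^+ 2 + (2 * a + b) * k%:R + (a + b + c)).
  by apply/funext => k; rewrite -natr1; ring.
by rewrite IH -natr1; ring.
Qed.

Lemma bernstein_cst n (c : R) x : (bernstein n (fun=> c)).[x] = c.
Proof.
have := bernstein_quadratic n 0 0 c x; rewrite !mul0r !add0r => {2}<-.
by congr (bernstein _ _).[_]; apply/funext => k; rewrite !mul0r !add0r.
Qed.

Lemma bernstein_bounded n u x (C : R) : 0 <= x <= 1 ->
  (forall k, `|u k| <= C) -> `|(bernstein n u).[x]| <= C.
Proof.
move=> x01 uC; rewrite ler_norml -{1}(bernstein_cst n (- C) x).
rewrite -{2}(bernstein_cst n C x) !le_bernstein// => k;
  by have := uC k; rewrite ler_norml => /andP[].
Qed.

(** Chebyshev's argument: away from [x] the bounded function [f] is dominated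
    by a multiple of [(y - x) ^+ 2], whose mean at [y = k / n] is
    [x (1 - x) / n]. *)
Lemma bernstein_cvg f x (C : R) : 0 <= x <= 1 -> (forall y, `|f y| <= C) ->
  {for x, continuous f} ->
  (bernstein n (fun k => f (k%:R / n%:R))).[x] @[n --> \oo] --> f x.
Proof.
move=> x01 fC cf; apply/cvgrPdist_lt => eps eps0.
have e2 : 0 < eps / 2 by rewrite divr_gt0.
have C0 : 0 <= C by apply: le_trans (fC 0).
have /cvgrPdist_lt/(_ _ e2)/nbhs_ballP[dl /= dl0 fdl] := cf.
pose K := 2 * C / dl ^+ 2.
have K0 : 0 <= K by apply: divr_ge0; [exact: mulr_ge0|exact: sqr_ge0].
have fK y : `|f y - f x| <= eps / 2 + K * (y - x) ^+ 2.
  have [xy|xy] := ltP `|x - y| dl.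
    by rewrite distrC ler_wpDr ?(mulr_ge0 K0) ?sqr_ge0// ltW//; exact: (fdl y xy).
  apply: ler_wpDl; first exact: ltW.
  apply: (@le_trans _ _ (2 * C)).
    apply: le_trans (ler_normB _ _) _.
    by rewrite mulr_natl mulr2n lerD.
  rewrite /K -mulrA ler_peMr ?mulr_ge0//.
  rewrite mulrC -ler_pdivrMr ?invr_gt0 ?exprn_gt0// invrK mul1r.
  rewrite -(real_normK (num_real (y - x))) distrC.
  by rewrite ler_pXn2r ?nnegrE ?(ltW dl0).
near=> n.
have n0 : 0 < n%:R :> R by rewrite ltr0n; near: n; exists 1%N.
have Kn : K * (x * (1 - x) / n%:R) < eps / 2.
  apply: (@le_lt_trans _ _ (K / n%:R)).
    rewrite ler_wpM2l// ler_pdivrMr// mulVf ?gt_eqF//.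
    by case/andP: x01 => x0 x1; nra.
  rewrite ltr_pdivrMr// mulrC -ltr_pdivrMr//.
  near: n; exact: nbhs_infty_gtr.
rewrite distrC.
have E (c K' : R) : (bernstein n
    (fun k => c + K' * (k%:R / n%:R - x) ^+ 2)).[x] =
    c + K' * (x * (1 - x) / n%:R).
  rewrite [X in bernstein n X](_ : _ = (fun k => (K' / n%:R ^+ 2) * k%:R ^+ 2 +
    (- (2 * K' * x / n%:R)) * k%:R + (c + K' * x ^+ 2))); last first.
    by apply/funext => k; field; rewrite gt_eqF.
  by rewrite bernstein_quadratic; field; rewrite gt_eqF.
apply: (@le_lt_trans _ _ (eps / 2 + K * (x * (1 - x) / n%:R))); last lra.
have /= := @le_bernstein n (fun k => f (k%:R / n%:R))
  (fun k => f x + eps / 2 + K * (k%:R / n%:R - x) ^+ 2) x x01.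
have /= := @le_bernstein n
  (fun k => f x - eps / 2 + (- K) * (k%:R / n%:R - x) ^+ 2)
  (fun k => f (k%:R / n%:R)) x x01.
rewrite !E => H1 H2; rewrite ler_norml.
have {}H1 : f x - eps / 2 + - K * (x * (1 - x) / n%:R) <=
    (bernstein n (fun k => f (k%:R / n%:R))).[x].
  by apply: H1 => k; have := fK (k%:R / n%:R); rewrite ler_norml => /andP[]; lra.
have {}H2 : (bernstein n (fun k => f (k%:R / n%:R))).[x] <=
    f x + eps / 2 + K * (x * (1 - x) / n%:R).
  by apply: H2 => k; have := fK (k%:R / n%:R); rewrite ler_norml => /andP[]; lra.
by apply/andP; split; lra.
Unshelve. all: by end_near. Qed.

End bernstein.

Section cosine_polynomials.
Variable R : realType.
Local Notation leb := (@lebesgue_measure R).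
Implicit Types (h : R -> R) (Q : {poly R}).

Lemma continuous_horner_cos Q : continuous (fun r : R => Q.[cos r]).
Proof.
move=> r; apply: (@continuous_comp _ _ _ cos (horner Q)).
  exact: continuous_cos.
exact: continuous_horner.
Qed.

Lemma continuous_measurable (f : R -> R) (D : set R) :
  continuous f -> measurable_fun D f.
Proof.
by move=> cf; apply: measurable_funTS; exact: continuous_measurable_fun.
Qed.

Lemma segment_lty (a b : R) : (leb `[a, b]%classic < +oo)%E.
Proof. by apply: compact_finite_measure; exact: segment_compact. Qed.

Lemma ae_segment (P : R -> Prop) (a b : R) : {in `]a, b[, forall r, P r} ->
  {ae leb, forall r, `[a, b]%classic r -> P r}.
Proof.
move=> Pab; exists [set a; b]; split => [||r /= nP].
- by apply: measurableU.
- by apply: countable_lebesgue_measure0; apply: finite_set_countable.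
apply: contrapT => /not_orP[ra rb]; apply: nP => rab.
apply: Pab; move: rab; rewrite !in_itv/= => /andP[h0 hpi].
by rewrite !lt_neqAle h0 hpi !andbT; apply/andP; split; apply/eqP;
  [move=> /esym|].
Qed.

Lemma bounded_integrable (f : R -> R) (a b C : R) :
  measurable_fun `[a, b] f -> (forall x, x \in `[a, b] -> `|f x| <= C) ->
  leb.-integrable `[a, b] (EFin \o f).
Proof.
move=> mf fC; apply: measurable_bounded_integrable => //.
  exact: segment_lty.
exists C; split; first exact: num_real.
by move=> y Cy x /= xab; rewrite (le_trans (fC _ _)) ?ltW.
Qed.

Definition clip (C x : R) : R := (`|x + C| - `|x - C|) / 2.

Lemma clip_bounded C x : 0 <= C -> `|clip C x| <= C.
Proof.
move=> C0; rewrite /clip; case: (ger0P (x + C)) => ?; case: (ger0P (x - C)) => ?;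
  rewrite ler_norml; apply/andP; split; lra.
Qed.

Lemma clip_closer C x y : `|y| <= C -> `|y - clip C x| <= `|y - x|.
Proof.
rewrite ler_norml => /andP[y1 y2]; rewrite /clip ler_norml.
have := ler_norm (y - x); have := ler_norm (- (y - x)); rewrite normrN => n1 n2.
by case: (ger0P (x + C)) => ?; case: (ger0P (x - C)) => ?;
  apply/andP; split; lra.
Qed.

Lemma continuous_clip C : continuous (clip C).
Proof.
have cn c : continuous (fun x : R => `|x + c|).
  by move=> x; apply: cvg_norm; apply: cvgD; [exact: cvg_id|exact: cvg_cst].
move=> r; apply: cvgM; last exact: cvg_cst.
by apply: cvgB; exact: cn.
Qed.

Lemma cos_polynomial_approx h (C eps : R) : measurable_fun [set: R] h ->
    (forall r, `|h r| <= C) -> 0 < eps ->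
  exists2 Q, forall r, `|Q.[cos r]| <= C &
    (\int[leb]_(r in `[0%R, pi]) (`|h r - Q.[cos r]|)%:E < eps%:E)%E.
Proof.
move=> mh hC eps0; have e2 : 0 < eps / 2 by rewrite divr_gt0.
have C0 : 0 <= C by apply: le_trans (hC 0).
have mD : measurable (`[0%R, pi]%classic : set R) by [].
have ih : leb.-integrable `[0%R, pi] (EFin \o h).
  by apply: (@bounded_integrable _ _ _ C) => //; exact: measurable_funTS.
have [g_ [cg ig g_cvg]] := approximation_continuous_integrable mD (segment_lty _ _) ih.
have [n] : exists n,
    (\int[leb]_(z in `[0%R, pi]) `|(h z - g_ n z)%:E| < (eps / 2)%:E)%E.
  have := g_cvg => /fine_cvgP[fin /cvgrPdist_lt/(_ _ e2) c].
  near \oo => n; exists n.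
  have nfin : (\int[leb]_(z in `[0%R, pi]) `|(h z - g_ n z)%:E|)%E \is a fin_num.
    by near: n.
  rewrite -(fineK nfin) lte_fin; apply: le_lt_trans (ler_norm _) _.
  by rewrite -normrN -sub0r; near: n; exact: c.
move: (g_ n) (cg n) (ig n) => g {}cg {}ig hg.
(* Clipping at [C] brings the approximation closer to [h] and makes it bounded,
   so that dominated convergence applies to its Bernstein polynomials. *)
pose gc r := clip C (g r).
have gcC r : `|gc r| <= C by exact: clip_bounded.
have hgc r : `|h r - gc r| <= `|h r - g r| by exact: clip_closer.
have cgc : continuous gc.
  by move=> r; apply: (@continuous_comp _ _ _ g (clip C));
    [exact: cg|exact: continuous_clip].
pose f y := gc (acos (2 * y - 1)).
pose Q k := bernstein k (fun i => f (i%:R / k%:R)) \Po (2^-1 *: ('X + 1)).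
have QE k r : (Q k).[cos r] =
    (bernstein k (fun i => f (i%:R / k%:R))).[2^-1 * (cos r + 1)].
  by rewrite /Q horner_comp !hornerE.
have x01 r : 0 <= 2^-1 * (cos r + 1) <= 1.
  by have := cos_geN1 r; have := cos_le1 r => ? ?; apply/andP; split; lra.
have QC k r : `|(Q k).[cos r]| <= C.
  by rewrite QE; apply: bernstein_bounded => // i; exact: gcC.
have Q_cvg r : r \in `]0%R, pi[ -> (Q k).[cos r] @[k --> \oo] --> gc r.
  move=> r0pi.
  have rE : acos (cos r) = r.
    by rewrite cosK// (subset_itv_oo_cc r0pi).
  under eq_fun do rewrite QE.
  have fE : f (2^-1 * (cos r + 1)) = gc r.
    by rewrite /f mulrA mulfV ?mul1r ?addrK ?rE.
  rewrite -fE; apply: (@bernstein_cvg _ _ _ C) => //; first by move=> y; exact: gcC.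
  apply: continuous_comp; last exact: cgc.
  apply: (@continuous_comp _ _ _ (fun y : R => 2 * y - 1) (@acos R)).
    by apply: cvgB; [apply: cvgM; [exact: cvg_cst|exact: cvg_id]|exact: cvg_cst].
  rewrite mulrA mulfV// mul1r addrK; apply: continuous_acos.
  have s0 : 0 < sin r.
    by apply: sin_gt0_pi; move: r0pi; rewrite in_itv.
  have := cos2Dsin2 r; nra.
have mQ k : measurable_fun `[0%R, pi] (EFin \o (fun r => (Q k).[cos r])).
  apply/measurable_EFinP; apply: continuous_measurable.
  exact: continuous_horner_cos.
have mgc : measurable_fun `[0%R, pi] (EFin \o gc).
  by apply/measurable_EFinP; exact: continuous_measurable.
have aeQ : {ae leb, forall r, `[0%R, pi]%classic r ->
    (EFin \o (fun r => (Q k).[cos r])) r @[k --> \oo] --> (EFin \o gc) r}.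
  apply: ae_segment => r r0pi; apply: cvg_EFin; first exact: nearW.
  exact: Q_cvg.
have icst : leb.-integrable `[0%R, pi] (EFin \o cst C).
  by apply: (@bounded_integrable _ _ _ C) => // r _; rewrite ger0_norm.
have bQ : {ae leb, forall r k, `[0%R, pi]%classic r ->
    (`|(EFin \o (fun r => (Q k).[cos r])) r| <= (EFin \o cst C) r)%E}.
  by apply: nearW => r k _; rewrite lee_fin; exact: QC.
have [_ dct _] := @dominated_convergence _ _ _ leb _ mD _ _ _ mQ mgc aeQ icst bQ.
have [k Hk] : exists k,
    (\int[leb]_(r in `[0%R, pi]) (`|(Q k).[cos r] - gc r|)%:E < (eps / 2)%:E)%E.
  have := dct => /fine_cvgP[fin /cvgrPdist_lt/(_ _ e2) c].
  near \oo => k; exists k.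
  have kfin : (\int[leb]_(r in `[0%R, pi]) (`|(Q k).[cos r] - gc r|)%:E)%E
    \is a fin_num by near: k.
  rewrite -(fineK kfin) lte_fin; apply: le_lt_trans (ler_norm _) _.
  by rewrite -normrN -sub0r; near: k; exact: c.
exists (Q k) => [r|]; first exact: QC.
have mg : measurable_fun `[0%R, pi] g by exact: continuous_measurable.
have mh' : measurable_fun `[0%R, pi] h by exact: measurable_funTS.
rewrite (splitr eps) EFinD.
apply: le_lt_trans (lteD hg Hk).
have mgc' : measurable_fun `[0%R, pi] gc by exact: continuous_measurable.
have mQ' : measurable_fun `[0%R, pi] (fun r => (Q k).[cos r]).
  by apply: continuous_measurable; exact: continuous_horner_cos.
have mdist (u v : R -> R) : measurable_fun `[0%R, pi] u -> measurable_fun `[0%R, pi] v ->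
    measurable_fun `[0%R, pi] (fun r : R => (`|u r - v r|)%:E).
  move=> mu mv; apply/measurable_EFinP; apply: measurableT_comp => //.
  exact: measurable_funB.
rewrite -ge0_integralD//; last 2 first.
- exact: mdist.
- exact: mdist.
apply: ge0_le_integral => //.
- exact: mdist.
- by apply: emeasurable_funD; exact: mdist.
- move=> r _ /=; rewrite lee_fin.
  apply: le_trans (lerD (hgc r) (lexx _)); rewrite [in leRHS](distrC (Q k).[cos r]).
  by rewrite (le_trans _ (ler_normD _ _))// subrKA.
Unshelve. all: by end_near. Qed.

End cosine_polynomials.

(** * Measures with a density *)

Section density.
Local Open Scope ereal_scope.
Context d (T : measurableType d) (R : realType).
Variables (lam nu : {measure set T -> \bar R}) (D : set T) (w : T -> R).
Hypotheses (mD : measurable D) (mw : measurable_fun D w).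
Hypothesis w0 : forall x, D x -> (0 <= w x)%R.
Hypothesis nuE : forall A, measurable A -> nu A = \int[lam]_(x in D `&` A) (w x)%:E.

Let g : T -> \bar R := (EFin \o w) \_ D.

Let mg : measurable_fun setT g.
Proof. by apply/(measurable_restrictT _ mD).1; exact/measurable_EFinP. Qed.

Let g0 x : 0 <= g x.
Proof. by apply: erestrict_ge0 => y Dy; rewrite lee_fin w0. Qed.

Let g_fin x : g x \is a fin_num.
Proof. by rewrite /g patchE; case: ifP. Qed.

Let nu_g A : measurable A -> nu A = \int[lam]_(x in A) g x.
Proof. by move=> mA; rewrite nuE// setIC integral_mkcondr. Qed.

Import HBNNSimple.

(** By monotone convergence it suffices to treat simple functions, for which
    the formula is the hypothesis on [nu]. *)
Lemma ge0_integral_density (f : T -> \bar R) :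
    measurable_fun setT f -> (forall x, 0 <= f x) ->
  \int[nu]_x f x = \int[lam]_(x in D) (f x * (w x)%:E).
Proof.
move=> mf f0.
have -> : \int[lam]_(x in D) (f x * (w x)%:E) = \int[lam]_x (f x * g x).
  rewrite integral_mkcond; apply: eq_integral => x _; rewrite /g !patchE.
  by case: ifP; rewrite ?mule0.
pose h := nnsfun_approx measurableT mf.
have -> : \int[nu]_x f x = lim (\int[nu]_x (EFin \o h n) x @[n --> \oo]).
  have fE x : f x = lim ((EFin \o h n) x @[n --> \oo]).
    by apply/esym/cvg_lim => //; exact: cvg_nnsfun_approx.
  under eq_integral => x _ do rewrite fE.
  apply: monotone_convergence => //.
  - by move=> n; apply/measurable_EFinP.
  - by move=> n x _ //=; rewrite lee_fin.
  - by move=> x _ a b ab; rewrite lee_fin; exact/lefP/nd_nnsfun_approx.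
have -> : \int[lam]_x (f x * g x) =
    lim (\int[lam]_x ((EFin \o h n) \* g) x @[n --> \oo]).
  have fg x : f x * g x = lim (((EFin \o h n) \* g) x @[n --> \oo]).
    by apply/esym/cvg_lim => //; apply: cvgeZr => //; exact: cvg_nnsfun_approx.
  under eq_integral => x _ do rewrite fg.
  apply: monotone_convergence => [//| | |].
  - by move=> n; apply/emeasurable_funM => //; exact/measurable_EFinP.
  - by move=> n x _ /=; rewrite mule_ge0 ?lee_fin.
  - move=> x _ a b ab/=; rewrite lee_wpmul2r//.
    by rewrite lee_fin; exact/lefP/nd_nnsfun_approx.
suff suf n : \int[nu]_x (EFin \o h n) x = \int[lam]_x ((EFin \o h n) x * g x).
  by under eq_fun do rewrite suf.
transitivity (\int[nu]_x
   (\sum_(y \in range (h n)) (y * \1_(h n @^-1` [set y]) x)%:E)).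
  by apply: eq_integral => t tE; rewrite /= fimfunE -fsumEFin.
have indich m r : measurable_fun setT (fun x => (r * \1_(h m @^-1` [set r]) x)%:E).
  by apply: (measurable_comp measurableT) => //; exact: measurable_funM.
rewrite ge0_integral_fsum//; last by move=> m y Ey; exact: nnfun_muleindic_ge0.
transitivity (\int[lam]_x (\sum_(y \in range (h n))
    (y * \1_(h n @^-1` [set y]) x)%:E * g x)); last first.
  under [RHS]eq_integral => x xE.
    rewrite /= fimfunE -fsumEFin// ge0_mule_fsuml => [|y]; last first.
      exact: nnfun_muleindic_ge0.
    over.
  by [].
rewrite ge0_integral_fsum//; last 2 first.
  - by move=> y; apply: emeasurable_funM.
  - by move=> m y Ey; rewrite mule_ge0 ?nnfun_muleindic_ge0.
apply: eq_fsbigr => r rhn.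
under [LHS]eq_integral do rewrite EFinM.
rewrite integralZl_indic_nnsfun => //.
under [RHS]eq_integral do rewrite EFinM -muleA.
rewrite ge0_integralZl//.
- under [in RHS]eq_integral do rewrite muleC.
  rewrite [in RHS](eq_integral (g \_ (h n @^-1` [set r]))); last first.
    by move=> x xE; rewrite epatch_indic.
  by rewrite -integral_mkcond -nu_g// integral_indic// setIT.
- by apply: emeasurable_funM => //; exact/measurable_EFinP.
- by move=> t Et; rewrite mule_ge0 ?lee_fin.
- by move: rhn; rewrite inE => -[t _ <-]; rewrite lee_fin.
Qed.

Lemma integral_density (f : T -> R) : measurable_fun setT f ->
  \int[nu]_x (f x)%:E = \int[lam]_(x in D) (f x * w x)%:E.
Proof.
move=> mf; rewrite integralE [RHS]integralE; congr (_ - _).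
- rewrite ge0_integral_density//; last first.
    by apply: measurable_funepos; exact/measurable_EFinP.
  apply: eq_integral => x; rewrite inE => /w0 wx.
  by rewrite !funeposE -EFin_max -EFinM maxr_pMl// mul0r -EFin_max.
- rewrite ge0_integral_density//; last first.
    by apply: measurable_funeneg; exact/measurable_EFinP.
  apply: eq_integral => x; rewrite inE => /w0 wx.
  by rewrite !funenegE -EFinN -EFin_max -EFinM maxr_pMl// mul0r mulNr -EFin_max.
Qed.

Lemma Rintegral_density (f : T -> R) : measurable_fun setT f ->
  (\int[nu]_x f x = \int[lam]_(x in D) (f x * w x))%R.
Proof. by move=> mf; rewrite /Rintegral integral_density. Qed.

Lemma density_ae_null (P : T -> Prop) :
  {ae lam, forall x, D x -> P x} -> {ae nu, forall x, P x}.
Proof.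
move=> [N [mN N0 NP]]; exists (N `|` ~` D); split.
- by apply: measurableU => //; exact: measurableC.
- rewrite nuE; last by apply: measurableU => //; exact: measurableC.
  rewrite setIUr setICr setU0; apply: null_set_integral => //.
  - exact: measurableI.
  - by apply/measurable_EFinP; apply: measurable_funS mw => //; exact: subIsetl.
  - apply: (@subset_measure0 _ _ _ lam _ N) => //; first exact: measurableI.
- move=> x /= nPx; have [Dx|] := pselect (D x); last by right.
  by left; apply: NP => /= /(_ Dx).
Qed.

End density.

(** * The weighted Schur test *)

Lemma measurable_inv (R : realType) : measurable_fun [set: R] (fun x : R => x^-1).
Proof.
have -> : (fun x : R => x^-1) = (fun x => if x == 0 then 0 else x^-1).
  by apply/funext => x; case: eqP => // ->; rewrite invr0.
apply: measurable_fun_if => //.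
  exact: measurable_fun_eqr.
rewrite setTI (_ : _ @^-1` _ = [set x | x != 0]); last first.
  by apply/seteqP; split => x /=; case: eqP.
apply: open_continuous_measurable_fun.
  exact: open_neq.
by move=> x; rewrite inE /= => x0; exact: inv_continuous.
Qed.

Section schur.
Context d1 d2 (T1 : measurableType d1) (T2 : measurableType d2) (R : realType).
Variables (m1 : {sigma_finite_measure set T1 -> \bar R})
          (m2 : {sigma_finite_measure set T2 -> \bar R}).

(** Cauchy-Schwarz follows from the arithmetic-geometric inequality with a free
    parameter [th], optimal at [th = z / V]; infinite values need no separate
    integrability hypothesis. *)
Let am_gm_bound (V : R) (z W : \bar R) : (0 <= z)%E -> 0 < V -> (0 <= W)%E ->
  (forall th, 0 < th -> (2%:E * z <= (th * V)%:E + th^-1%:E * W)%E) ->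
  (z * z <= V%:E * W)%E.
Proof.
move=> z0 V0 W0 H.
case: W W0 H => [W| |//] W0 H; last by rewrite gt0_muley// leey.
case: z z0 H => [z| |//] z0 H; last first.
  by have := H 1 ltr01; rewrite gt0_muley// -EFinM -EFinD leye_eq.
move: z0; rewrite lee_fin le_eqVlt => /predU1P[<-|z0].
  by rewrite mul0e mule_ge0// lee_fin ltW.
have := H (z / V); rewrite divr_gt0// => /(_ isT).
rewrite -!EFinM -EFinD !lee_fin divfK ?gt_eqF// invf_div => H'.
have : 2 * z * z <= (z + V / z * W) * z by rewrite ler_wpM2r// ltW.
have -> : (z + V / z * W) * z = z * z + V * W by field; rewrite gt_eqF.
lra.
Qed.

(** Weighing the Cauchy-Schwarz inequality by [u] bounds [T x * T x] by
    [v x * \int K x y * b y * h y ^ 2 / u y]. Exchanging the order of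
    integration then brings in the transposed kernel applied to [a * v]. *)
Lemma schur_test (a v : T1 -> R) (b u h : T2 -> R) (K : T1 -> T2 -> R) (c : R) :
    measurable_fun setT a -> measurable_fun setT v ->
    measurable_fun setT b -> measurable_fun setT u -> measurable_fun setT h ->
    measurable_fun setT (fun z : T1 * T2 => K z.1 z.2) ->
    (forall x, 0 <= a x) -> (forall y, 0 <= b y) -> (forall x y, 0 <= K x y) ->
    (forall y, 0 <= h y) -> 0 <= c ->
    (forall x, 0 <= v x) -> (forall y, 0 <= u y) ->
    (forall x, a x != 0 -> 0 < v x) -> (forall y, b y != 0 -> 0 < u y) ->
    (forall x, a x != 0 -> (\int[m2]_y (K x y * (b y * u y))%:E <= (v x)%:E)%E) ->
    (forall y, b y != 0 ->
      (\int[m1]_x (K x y * (a x * v x))%:E <= (c * u y)%:E)%E) ->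
  forall T : T1 -> \bar R,
    (forall x, T x = \int[m2]_y (K x y * (b y * h y))%:E)%E ->
  (\int[m1]_x ((a x)%:E * (T x * T x)) <= c%:E * \int[m2]_y (b y * h y ^+ 2)%:E)%E.
Proof.
move=> ma mv mb mu mh mK a0 b0 K0 h0 c0 v0 u0 vp up Ku Kv T TE.
have mKr x : measurable_fun setT (K x).
  exact: (measurableT_comp mK (pair1_measurable x)).
have mKl y : measurable_fun setT (K ^~ y).
  exact: (measurableT_comp mK (pair2_measurable y)).
have muV : measurable_fun setT (fun y => (u y)^-1).
  exact: (measurableT_comp (@measurable_inv R) mu).
pose q y := b y * h y ^+ 2 / u y.
have q0 y : 0 <= q y by rewrite /q divr_ge0// mulr_ge0// sqr_ge0.
have iu0 y : 0 <= (u y)^-1 by rewrite invr_ge0.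
have hh0 y : 0 <= h y ^+ 2 by exact: sqr_ge0.
have mq : measurable_fun setT q.
  by apply: measurable_funM => //; apply: measurable_funM => //; exact: measurable_funX.
pose f (z : T1 * T2) := ((a z.1 * v z.1) * (K z.1 z.2 * q z.2))%:E.
have f0 z : (0 <= f z)%E by rewrite /f lee_fin !mulr_ge0.
have mf : measurable_fun setT f.
  apply/measurable_EFinP; apply: measurable_funM.
    by apply: measurable_funM; exact: (measurableT_comp _ measurable_fst).
  by apply: measurable_funM => //; exact: (measurableT_comp mq measurable_snd).
have T0 x : (0 <= T x)%E.
  by rewrite TE; apply: integral_ge0 => y _; rewrite lee_fin !mulr_ge0.
have mT : measurable_fun setT T.
  rewrite (funext TE : T = _).
  apply: (measurable_fun_fubini_tonelli_F (m2 := m2)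
    (fun z => (K z.1 z.2 * (b z.2 * h z.2))%:E)).
    apply/measurable_EFinP; apply: measurable_funM => //.
    by apply: measurable_funM; exact: (measurableT_comp _ measurable_snd).
  by move=> z; rewrite lee_fin !mulr_ge0.
apply: (@le_trans _ _ (\int[m1]_x \int[m2]_y f (x, y))%E).
  apply: ge0_le_integral => //.
  - by move=> x _; rewrite !mule_ge0// lee_fin.
  - apply: emeasurable_funM; first exact/measurable_EFinP.
    exact: emeasurable_funM.
  - exact: measurable_fun_fubini_tonelli_F.
  move=> x _; have [ax0|ax0] := eqVneq (a x) 0.
    by rewrite ax0 mul0e; apply: integral_ge0.
  under eq_integral do rewrite /f/= EFinM.
  have mKq : measurable_fun setT (fun y => (K x y * q y)%:E).
    by apply/measurable_EFinP; exact: measurable_funM.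
  rewrite ge0_integralZl//; last 2 first.
  - by move=> y _; rewrite lee_fin mulr_ge0.
  - by rewrite lee_fin mulr_ge0.
  rewrite EFinM -muleA; apply: lee_wpmul2l; first by rewrite lee_fin.
  apply: am_gm_bound => //; first exact: vp.
    by apply: integral_ge0 => y _; rewrite lee_fin mulr_ge0.
  move=> th th0.
  apply: (@le_trans _ _ (\int[m2]_y (2 * (K x y * (b y * h y)))%:E)%E).
    rewrite TE; under [leRHS]eq_integral do rewrite EFinM.
    rewrite ge0_integralZl//; last 2 first.
    - by apply/measurable_EFinP; apply: measurable_funM => //; exact: measurable_funM.
    - by move=> y _; rewrite lee_fin !mulr_ge0.
  apply: (@le_trans _ _ (\int[m2]_y ((th * (K x y * (b y * u y)))%:E +
                                   (th^-1 * (K x y * q y))%:E))%E).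
    apply: ge0_le_integral => //.
    - by move=> y _; rewrite lee_fin !mulr_ge0.
    - by apply/measurable_EFinP; do !apply: measurable_funM => //.
    - by apply: emeasurable_funD; apply/measurable_EFinP; do !apply: measurable_funM => //.
    move=> y _; rewrite -EFinD lee_fin.
    rewrite !(mulrCA _ (K x y)) -mulrDr ler_wpM2l//.
    have [by0|by0] := eqVneq (b y) 0; first by rewrite /q by0 !(mul0r, mulr0, addr0).
    have uy := up _ by0.
    rewrite (_ : 2 * _ = b y * (2 * h y)); last by ring.
    rewrite (_ : _ + _ = b y * (th * u y + th^-1 * (h y ^+ 2 / u y))); last first.
      by rewrite /q; ring.
    rewrite ler_wpM2l//.
    have -> : th^-1 * (h y ^+ 2 / u y) = th * u y * (h y / (th * u y)) ^+ 2.
      by field; rewrite !gt_eqF.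
    have -> : 2 * h y = th * u y * (2 * (h y / (th * u y))).
      by field; rewrite !gt_eqF.
    rewrite -[X in _ <= X + _]mulr1 -mulrDr ler_wpM2l//.
      by rewrite mulr_ge0// ltW.
    have := sqr_ge0 (1 - h y / (th * u y)); nra.
  rewrite ge0_integralD//.
  - rewrite leeD//.
      under eq_integral do rewrite EFinM.
      rewrite ge0_integralZl//; last 3 first.
      - by apply/measurable_EFinP; do !apply: measurable_funM => //.
      - by move=> y _; rewrite lee_fin !mulr_ge0.
      - by rewrite lee_fin ltW.
      by rewrite EFinM lee_pmul2l// ?Ku// lte_fin.
    under eq_integral do rewrite EFinM.
    rewrite ge0_integralZl//.
    - by move=> y _; rewrite lee_fin !mulr_ge0.
    - by rewrite lee_fin invr_ge0 ltW.
  - by move=> y _; rewrite lee_fin !mulr_ge0// ltW.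
  - by apply/measurable_EFinP; do !apply: measurable_funM => //.
  - by move=> y _; rewrite lee_fin !mulr_ge0// invr_ge0 ltW.
  - by apply/measurable_EFinP; do !apply: measurable_funM => //.
rewrite fubini_tonelli//.
rewrite -ge0_integralZl//; last 2 first.
- by apply/measurable_EFinP; do !apply: measurable_funM => //; exact: measurable_funX.
- by move=> y _; rewrite lee_fin mulr_ge0// sqr_ge0.
apply: ge0_le_integral => //.
- by move=> y _; exact: integral_ge0.
- exact: measurable_fun_fubini_tonelli_G.
- apply/measurable_EFinP; apply: measurable_funM => //.
  by apply: measurable_funM => //; exact: measurable_funX.
move=> y _; have [by0|by0] := eqVneq (b y) 0.
  rewrite integral0_eq ?by0 ?mul0r ?mule0// => x _.
  by rewrite /f/= /q by0 !(mul0r, mulr0).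
have uy := up _ by0.
rewrite (eq_integral (fun x => (q y)%:E * (K x y * (a x * v x))%:E)%E); last first.
  by move=> x _; rewrite -EFinM /f/=; congr EFin; ring.
rewrite ge0_integralZl//.
- apply: (@le_trans _ _ ((q y)%:E * (c * u y)%:E)%E).
    by apply: lee_wpmul2l; rewrite ?lee_fin// Kv.
  rewrite -!EFinM lee_fin /q le_eqVlt; apply/orP; left; apply/eqP.
  by field; rewrite gt_eqF.
- by apply/measurable_EFinP; do !apply: measurable_funM => //.
- by move=> x _; rewrite lee_fin !mulr_ge0.
- by rewrite lee_fin.
Qed.

End schur.

(** * Jacobi polynomials *)

Section jacobi_polynomials.
Variable R : realType.
Implicit Types (a b l : R) (p : {poly R}) (k s : nat).

Definition jacobi_op a b l p : {poly R} :=
  (1 - 'X ^+ 2) * p^`()^`() + ((b - a)%:P - (a + b + 2)%:P * 'X) * p^`() + l%:P * p.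

(** In the variable [y] with [x = 2 y + 1] the Jacobi equation becomes a
    two-term recursion between consecutive coefficients. *)
Lemma coef_jacobi_op a b l p s :
  let q := p \Po (2%:P * 'X + 1) in
  (jacobi_op a b l p \Po (2%:P * 'X + 1))`_s =
  (l - s%:R * (s%:R + a + b + 1)) * q`_s - (s%:R + 1) * (a + 1 + s%:R) * q`_s.+1.
Proof.
move=> q.
have -> : jacobi_op a b l p \Po (2%:P * 'X + 1) =
   l *: q - (a + 1) *: q^`() - (a + b + 2) *: ('X * q^`())
   - 'X * q^`()^`() - 'X ^+ 2 * q^`()^`().
  have dL (r : {poly R}) :
      (r \Po (2%:P * 'X + 1))^`() = 2%:P * (r^`() \Po (2%:P * 'X + 1)).
    by rewrite deriv_comp !poly.derivE; ring.
  rewrite /jacobi_op /q !dL derivM derivC mul0r add0r dL -!mul_polyC.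
  have cN (r : {poly R}) : (- r) \Po (2%:P * 'X + 1) = - (r \Po (2%:P * 'X + 1)).
    exact: raddfN.
  rewrite !(comp_polyD, cN, comp_polyM, comp_polyC, comp_polyX, expr2).
  by ring.
move: q => q; rewrite !(coefB, coefZ, coefXM, coefXnM, coef_deriv).
case: s => [|[|s]]; first by rewrite /=; ring.
  by rewrite /=; ring.
by rewrite subn2 /=; ring.
Qed.

Let shift_inj (p q : {poly R}) :
  p \Po (2%:P * 'X + 1) = q \Po (2%:P * 'X + 1) -> p = q.
Proof.
move=> /(congr1 (comp_poly (2^-1 *: ('X - 1)))); rewrite -!comp_polyA.
have -> : (2%:P * 'X + 1) \Po (2^-1 *: ('X - 1)) = 'X :> {poly R}.
  rewrite comp_polyD comp_polyM !comp_polyC comp_polyX.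
  rewrite -mul_polyC mulrA -polyCM mulfV// mul1r.
  by rewrite subrK.
by rewrite !comp_polyXr.
Qed.

Definition jacobi_coef a b k s : R :=
  (\prod_(0 <= i < s) (k%:R + a + b + 1 + i%:R)) *
  (\prod_(s <= i < k) (a + 1 + i%:R)) / (s`! * (k - s)`!)%:R.

Lemma jacobi_shift a b k :
  jacobi a b k \Po (2%:P * 'X + 1) = \poly_(s < k.+1) jacobi_coef a b k s.
Proof.
rewrite poly_def /jacobi raddf_sum /=; apply: eq_bigr => s _.
rewrite -!mul_polyC comp_polyM comp_polyC; congr (_ * _).
rewrite rmorphXn /=; congr (_ ^+ _).
rewrite comp_polyM comp_polyC comp_polyD comp_polyX.
rewrite -polyCN comp_polyC polyCN addrK mulrA -polyCM mulVf// mul1r//.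
Qed.

Lemma jacobi_coefS a b k s : (s < k)%N ->
  (s%:R + 1) * (a + 1 + s%:R) * jacobi_coef a b k s.+1 =
  (k%:R - s%:R) * (k%:R + s%:R + a + b + 1) * jacobi_coef a b k s.
Proof.
move=> sk; rewrite /jacobi_coef big_nat_recr//= [in RHS](big_ltn sk).
have -> : (k - s)%N = (k - s.+1).+1 by rewrite subnSK.
have -> : k%:R - s%:R = (k - s.+1).+1%:R :> R by rewrite subnSK// natrB// ltnW.
rewrite !factS !natrM -!natr1.
have f0 j : j`!%:R != 0 :> R by rewrite pnatr_eq0 -lt0n fact_gt0.
have n0 j : j%:R + 1 != 0 :> R by rewrite natr1 pnatr_eq0.
by field; rewrite !f0 !n0.
Qed.

Lemma jacobi_ode a b k :
  jacobi_op a b (k%:R * (k%:R + a + b + 1)) (jacobi a b k) = 0.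
Proof.
apply: shift_inj; apply/polyP => s; rewrite coef_jacobi_op jacobi_shift.
rewrite comp_poly0 coef0 !coef_poly; have [sk|] := ltnP s k.
  rewrite ltnS (ltnW sk) ltnS sk jacobi_coefS//.
  by rewrite -[RHS](mul0r (jacobi_coef a b k s)) -mulrBl; congr (_ * _); ring.
rewrite leq_eqVlt => /predU1P[<-|ks]; first by rewrite !ltnS leqnn ltnn; ring.
have -> : (s < k.+1)%N = false by rewrite ltnNge ks.
have -> : (s.+1 < k.+1)%N = false by rewrite ltnNge ltnS (ltnW ks).
by ring.
Qed.

Lemma jacobi_at1_neq0 a b k : -1 < a -> (jacobi a b k).[1] != 0.
Proof.
move=> a1; rewrite jacobi_at1 mulf_neq0//.
  rewrite big_mkord; apply/prodf_neq0 => i _.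
  by rewrite gt_eqF// (lt_le_trans (_ : 0 < a + 1)) ?lerDl//; lra.
Qed.

(** The value at [x = 1] is the coefficient of index [0] in [y], and for
    [a > -1] the recursion determines all the others from it. *)
Lemma jacobi_unique a b k p : -1 < a ->
  jacobi_op a b (k%:R * (k%:R + a + b + 1)) p = 0 ->
  p = (p.[1] / (jacobi a b k).[1]) *: jacobi a b k.
Proof.
move=> a1 p0; have J0 := jacobi_at1_neq0 b k a1.
have at1 (q : {poly R}) : (q \Po (2%:P * 'X + 1))`_0 = q.[1].
  by rewrite -horner_coef0 horner_comp !hornerE.
apply: shift_inj; rewrite comp_polyZ.
apply/polyP => s; rewrite coefZ; elim: s => [|s IH].
  by rewrite !at1 divfK.
have rec (q : {poly R}) : jacobi_op a b (k%:R * (k%:R + a + b + 1)) q = 0 ->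
    (s%:R + 1) * (a + 1 + s%:R) * (q \Po (2%:P * 'X + 1))`_s.+1 =
    (k%:R * (k%:R + a + b + 1) - s%:R * (s%:R + a + b + 1)) *
      (q \Po (2%:P * 'X + 1))`_s.
  move=> q0; have := coef_jacobi_op a b (k%:R * (k%:R + a + b + 1)) q s.
  by rewrite q0 comp_poly0 coef0 /= => /esym/eqP; rewrite subr_eq0 => /eqP.
have s0 : (s%:R + 1) * (a + 1 + s%:R) != 0.
  have ? : 0 <= s%:R :> R by [].
  by rewrite mulf_neq0// gt_eqF//; lra.
apply: (mulfI s0); rewrite rec// IH mulrCA -rec ?jacobi_ode//; ring.
Qed.

(** The quadratic transformation: both sides solve the same Jacobi equation. *)
Lemma jacobi_quadratic a k : -1 < a ->
  exists2 c : R, c != 0 &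
    jacobi a a (2 * k) = c *: (jacobi a (- 2^-1) k \Po (2%:P * 'X ^+ 2 - 1)).
Proof.
move=> a1; set J := jacobi _ (- _) _; set L := _ - 1.
have J0 : J.[1] != 0 by exact: jacobi_at1_neq0.
have K0 := jacobi_at1_neq0 a (2 * k) a1.
have L1 : (J \Po L).[1] = J.[1].
  by rewrite horner_comp; congr (J.[_]); rewrite /L !hornerE /=; ring.
have dL (r : {poly R}) : (r \Po L)^`() = 4%:P * 'X * (r^`() \Po L).
  by rewrite deriv_comp /L !poly.derivE; ring.

suff /jacobi_unique : jacobi_op a a ((2 * k)%:R * ((2 * k)%:R + a + a + 1)) (J \Po L) = 0.
  move=> /(_ a1); rewrite L1 => ->.
  exists ((jacobi a a (2 * k)).[1] / J.[1]); first by rewrite mulf_neq0// invr_eq0.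
  by rewrite scalerA mulrA divfK// divff// scale1r.
have := jacobi_ode a (- 2^-1) k => /(congr1 (fun r => 4%:P * (r \Po L))).
rewrite comp_poly0 mulr0 => <-; rewrite /jacobi_op.
rewrite !dL derivM dL !poly.derivE.
have cN (r : {poly R}) : (- r) \Po L = - (r \Po L) by exact: raddfN.
rewrite !(comp_polyD, cN, comp_polyM, comp_polyC, comp_polyX, expr2).
rewrite -/J -/L natrM.
have E1 : 4%:P * (- 2^-1 - a)%:P = (- 2 - 4 * a)%:P.
  by rewrite -polyCM; congr polyC; field.
have E2 : 4%:P * (a - 2^-1 + 2)%:P = (4 * a + 6)%:P.
  by rewrite -polyCM; congr polyC; field.
have E3 : 4%:P * (k%:R * (k%:R + a - 2^-1 + 1))%:P =
    (2 * k%:R * (2 * k%:R + a + a + 1))%:P.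
  by rewrite -polyCM; congr polyC; field.
transitivity (4%:P * (1%:P - L * L) * (J^`()^`() \Po L) +
    ((- 2 - 4 * a)%:P - (4 * a + 6)%:P * L) * (J^`() \Po L) +
    (2 * k%:R * (2 * k%:R + a + a + 1))%:P * (J \Po L)).
  by rewrite /L; ring.
by rewrite -E1 -E2 -E3; ring.
Qed.

Lemma size_jacobi a b k : -1 < a -> -1 < a + b -> size (jacobi a b k) = k.+1.
Proof.
move=> a1 ab; rewrite -(@size_comp_poly2 _ _ (2%:P * 'X + 1)); last first.
  by rewrite size_MXaddC polyC_eq0 pnatr_eq0/= size_polyC pnatr_eq0.
rewrite jacobi_shift size_poly_eq// /jacobi_coef subnn.
rewrite [\prod_(k <= i < k) _]big_geq// mulr1.
rewrite mulf_neq0//.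
rewrite big_mkord; apply/prodf_neq0 => i _; rewrite gt_eqF//.
have ? : 0 <= i%:R :> R by [].
have : 1 <= k%:R :> R by rewrite ler1n (leq_ltn_trans _ (ltn_ord i)).
by lra.
Qed.

Lemma size_deriv_jacobi a b k : -1 < a -> -1 < a + b ->
  size (jacobi a b k.+1)^`() = k.+1.
Proof. by move=> a1 ab; rewrite size_deriv size_jacobi. Qed.

End jacobi_polynomials.

(** * Measurability of indefinite integrals *)

Section indefinite_integrals.
Variable R : realType.
Local Notation leb := (@lebesgue_measure R).
Implicit Types (f : R -> R) (h : R * R -> R).

Lemma measurable_Rintegral_param h : measurable_fun setT h ->
  measurable_fun setT (fun x => \int[leb]_y h (x, y)).
Proof.
move=> mh; have mE : measurable_fun setT (EFin \o h) by exact/measurable_EFinP.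
apply: (measurableT_comp (fine_measurable measurableT)).
under eq_fun do rewrite integralE.
apply: emeasurable_funB.
  rewrite (_ : (fun x => _) = fubini_F leb ((EFin \o h)^\+)%E); last first.
    by apply/funext => x; apply: eq_integral => y _; rewrite !funeposE.
  by apply: measurable_fun_fubini_tonelli_F => //; exact: measurable_funepos.
rewrite (_ : (fun x => _) = fubini_F leb ((EFin \o h)^\-)%E); last first.
  by apply/funext => x; apply: eq_integral => y _; rewrite !funenegE.
by apply: measurable_fun_fubini_tonelli_F => //; exact: measurable_funeneg.
Qed.

Lemma measurable_Rintegral_itv f (a b : R -> R) :
    measurable_fun setT a -> measurable_fun setT b -> measurable_fun setT f ->
  measurable_fun setT (fun r => \int[leb]_(t in `[a r, b r]) f t).
Proof.
move=> ma mb mf; pose h (z : R * R) :=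
  if (a z.1 <= z.2) && (z.2 <= b z.1) then f z.2 else 0.
have -> : (fun r => \int[leb]_(t in `[a r, b r]) f t) =
    (fun r => \int[leb]_t h (r, t)).
  apply/funext => r; rewrite Rintegral_mkcond; apply: eq_Rintegral => t _.
  by rewrite patchE mem_setE in_itv.
apply: measurable_Rintegral_param; apply: measurable_fun_ifT => //.
- apply: measurable_and; apply: measurable_fun_ler => //.
  + exact: (measurableT_comp ma measurable_fst).
  + exact: (measurableT_comp mb measurable_fst).
- exact: (measurableT_comp mf measurable_snd).
Qed.

(** Two-sided differentiability at the end points spares the one-sided limits
    of the general statement. *)
Lemma Rintegral_FTC (F f : R -> R) (a b : R) : a <= b ->
  {in `[a, b], forall x : R, is_derive x 1 F (f x)} ->
  {in `[a, b], forall x : R, {for x, continuous f}} ->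
  \int[leb]_(t in `[a, b]) f t = F b - F a.
Proof.
rewrite le_eqVlt => /predU1P[<- _ _|ab dF cf].
  by rewrite set_itv1 Rintegral_set1 subrr.
have cF x : x \in `[a, b] -> {for x, continuous F}.
  by move=> /dF [dFx _]; apply/differentiable_continuous/derivable1_diffP.
rewrite /Rintegral (@continuous_FTC2 _ f F a b ab)//.
- by apply: continuous_in_subspaceT => x /[!inE] /cf.
- split.
  + by move=> x xab; have [] := dF _ (subset_itv_oo_cc xab).
  + by apply: cvg_at_right_filter; apply: cF; rewrite bound_itvE ltW.
  + by apply: cvg_at_left_filter; apply: cF; rewrite bound_itvE ltW.
- by move=> x /subset_itv_oo_cc /dF [_ <-]; rewrite derive1E.
Qed.

Lemma continuous_itv_integrable f (a b : R) :
  {in `[a, b], forall x : R, {for x, continuous f}} ->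
  leb.-integrable `[a, b] (EFin \o f).
Proof.
move=> cf; apply: continuous_compact_integrable; first exact: segment_compact.
by apply: continuous_in_subspaceT => x /[!inE] /cf.
Qed.

Lemma continuous_itv_integral_lty f (a b : R) :
  {in `[a, b], forall x : R, {for x, continuous f}} ->
  (\int[leb]_(x in `[a, b]) (f x)%:E < +oo)%E.
Proof.
move=> /continuous_itv_integrable if_.
have : (\int[leb]_(x in `[a, b]) (f x)%:E)%E \is a fin_num.
  exact: integrable_fin_num.
by rewrite fin_numElt => /andP[].
Qed.

End indefinite_integrals.

(** * The radial Sturm-Liouville problem *)

Section positivity.
Variable R : realType.
Local Notation leb := (@lebesgue_measure R).

Lemma Rintegral_gt0 (f : R -> R) (a b x0 : R) :
  {in `[a, b], forall x : R, {for x, continuous f}} ->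
  {in `[a, b], forall x, 0 <= f x} -> x0 \in `]a, b[ -> 0 < f x0 ->
  0 < \int[leb]_(x in `[a, b]) f x.
Proof.
move=> cf f0 /[!in_itv]/= /andP[ax xb] fx0.
have f2 : 0 < f x0 / 2 by rewrite divr_gt0.
have x0ab : x0 \in `[a, b] by rewrite in_itv/= !ltW.
have /cvgrPdist_lt/(_ _ f2)/nbhs_ballP[dl /= dl0 fdl] := cf _ x0ab.
pose e := Num.min (dl / 2) (Num.min (x0 - a) (b - x0)).
have e0 : 0 < e by rewrite !lt_min !subr_gt0 ax xb divr_gt0.
have [edl ea eb] : [/\ e <= dl / 2, e <= x0 - a & e <= b - x0].
  by rewrite /e !ge_min !lexx !orbT.
have int_f : leb.-integrable `[a, b] (EFin \o f).
  exact: continuous_itv_integrable.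
have mf : measurable_fun `[a, b] (fun x => (f x)%:E) := measurable_int _ int_f.
have sub : `[x0 - e, x0 + e] `<=` `[a, b]%classic.
  by apply: subset_itv; rewrite bnd_simp; lra.
rewrite -lte_fin /Rintegral fineK; last exact: integrable_fin_num.
apply: (@lt_le_trans _ _ (f x0 / 2 * (2 * e))%:E).
  by rewrite lte_fin !mulr_gt0.
apply: (@le_trans _ _ (\int[leb]_(x in `[(x0 - e)%R, (x0 + e)%R]) (f x)%:E)%E).
  apply: (@le_trans _ _ (\int[leb]_(x in `[(x0 - e)%R, (x0 + e)%R]) (f x0 / 2)%:E)%E).
    rewrite integral_cst//= lebesgue_measure_itv/= lte_fin.
    rewrite ifT; last by lra.
    by rewrite -EFinD -EFinM lee_fin; nra.
  apply: ge0_le_integral => //.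
  - by move=> x _; rewrite lee_fin ltW.
  - exact: (measurable_funS _ sub mf).
  - move=> x; rewrite /= in_itv/= => /andP[x1 x2]; rewrite lee_fin.
    have : `|f x0 - f x| < f x0 / 2.
      by apply: fdl; rewrite /ball/= ltr_norml; apply/andP; split; lra.
    by rewrite ltr_norml => /andP[]; lra.
exact: ge0_subset_integral.
Qed.

End positivity.

Section radial_weight.
Variables (R : realType) (M : crossSpace) (n : nat).
Hypothesis nM : valid_dim M n.
Local Notation leb := (@lebesgue_measure R).
Local Notation w := (@dvol R M n).
Local Notation v := (@vol R M n).
Local Notation a := (@jalpha R n).

(** The second Jacobi parameter of the weight. On the real projective space the
    even polynomials [P_{2k}] of parameters [(a, a)] in [cos (r / 2)] are Jacobi
    polynomials of parameters [(a, -1/2)] in [cos r], so that one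
    change of variable, [x = cos r], serves the four families. *)
Definition weight_beta : R :=
  match M with RealProj => - 2^-1 | _ => jbeta R M n end.
Local Notation b := weight_beta.

Lemma jalpha_ge0 : 0 <= a.
Proof.
have : (2 <= n)%N.
  by case: M nM => //= /andP[h _]; exact: leq_trans h.
by rewrite -(ler_nat R) /jalpha => n2; rewrite divr_ge0// subr_ge0.
Qed.

Lemma jalpha_gtN1 : -1 < a.
Proof. by have := jalpha_ge0; lra. Qed.

Lemma weight_beta_geN : - 2^-1 <= b.
Proof.
have := jalpha_ge0; rewrite /weight_beta; case: M => //=; rewrite /jalpha; lra.
Qed.

Lemma weight_sum_gtN1 : -1 < a + b.
Proof. by have := jalpha_ge0; have := weight_beta_geN; lra. Qed.

Lemma eigval_jacobi k : eigval R M n k = - (k%:R * (k%:R + a + b + 1)).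
Proof.
rewrite /eigval /weight_beta; case: M => //=.
by congr (- (_ * _)); rewrite /jalpha; field.
Qed.

Lemma eigval_lt0 k : eigval R M n k.+1 < 0.
Proof.
rewrite eigval_jacobi oppr_lt0 mulr_gt0 ?ltr0Sn//.
have := weight_sum_gtN1; have : 0 <= k.+1%:R :> R by [].
by lra.
Qed.

Lemma eigval_neq0 k : (1 <= k)%N -> eigval R M n k != 0.
Proof. by case: k => // k _; rewrite lt_eqF// eigval_lt0. Qed.

Lemma eigval_inj j k : eigval R M n j = eigval R M n k -> j = k.
Proof.
rewrite !eigval_jacobi => /oppr_inj e.
have : (j%:R - k%:R) * (j%:R + k%:R + a + b + 1) = 0 :> R.
  by apply/eqP; rewrite -subr_eq0; apply/eqP; transitivity
    (j%:R * (j%:R + a + b + 1) - k%:R * (k%:R + a + b + 1)); [ring|rewrite e subrr].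
move=> /eqP; rewrite mulf_eq0 => /orP[|]; first by rewrite subr_eq0 eqr_nat => /eqP.
have := weight_sum_gtN1; have : 0 <= j%:R :> R by []; have : 0 <= k%:R :> R by [].
by move=> ? ? ?; rewrite gt_eqF//; lra.
Qed.

Let half_angle (r : R) : sin r = 2 * sin (r / 2) * cos (r / 2) /\
  cos r = 2 * cos (r / 2) ^+ 2 - 1.
Proof.
have -> : sin r = sin ((r / 2) *+ 2) by congr sin; rewrite mulr2n; field.
have -> : cos r = cos ((r / 2) *+ 2) by congr cos; rewrite mulr2n; field.
by rewrite sin_mulr2n cos_mulr2n; split; ring.
Qed.

Let is_derive_half_sin (m : nat) (r : R) :
  is_derive r 1 (fun x : R => sin (x / 2) ^+ m.+1)
    (m.+1%:R * sin (r / 2) ^+ m * (cos (r / 2) / 2)).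
Proof.
have d1 : is_derive r 1 (fun x : R => x / 2) (2^-1).
  rewrite (_ : (fun x => _) = 2^-1 \*: id); last by apply/funext => x; rewrite mulrC.
  by apply: is_derive_eq; rewrite /= scaler1.
have d2 : is_derive r 1 (@sin R \o (fun x : R => x / 2)) (cos (r / 2) / 2).
  by apply: is_derive1_comp; exact: is_derive_sin.
by have := is_deriveX m.+1 d2; rewrite exprfctE.
Qed.

Let is_derive_sinX (m : nat) (r : R) :
  is_derive r 1 (fun x : R => sin x ^+ m.+1) (m.+1%:R * sin r ^+ m * cos r).
Proof. by have := is_deriveX m.+1 (is_derive_sin r); rewrite exprfctE. Qed.

(** This is the logarithmic derivative of
    [(1 - cos r) ^ a (1 + cos r) ^ b sin r], freed of denominators; the real
    powers are thereby avoided. *)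
Lemma is_derive_dvol (r : R) : exists2 d : R, is_derive r 1 w d &
  sin r * d = w r * (a - b + (a + b + 1) * cos r).
Proof.
have [sE cE] := half_angle r.
rewrite /dvol /weight_beta /jbeta /jalpha; case: M nM => /= [n2|n2|/andP[n4 _]|/andP[n8 _]].
- have [m nE] : exists m, n = m.+2 by exists (n - 2)%N; rewrite -addn2 subnK.
  rewrite nE subn1 /=; eexists; first exact: is_derive_sinX.
  by rewrite exprS -!natr1; field.
- have [m nE] : exists m, n = m.+2 by exists (n - 2)%N; rewrite -addn2 subnK.
  rewrite nE subn1 /=; eexists; first exact: is_derive_half_sin.
  by rewrite sE cE exprS -!natr1; field.
- have [m nE] : exists m, n = m.+3.
    by exists (n - 3)%N; rewrite -addn3 subnK// (leq_trans _ n4).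
  rewrite nE !subSS subn0; eexists.
    exact: (is_deriveM (is_derive_sin r) (is_derive_half_sin m r)).
  by rewrite /GRing.scale /= sE cE exprS -!natr1; field.
- have [m nE] : exists m, n = m.+1.+4.
    by exists (n - 5)%N; rewrite -{1}(subnK (leq_trans (isT : (5 <= 8)%N) n8)) addnC.
  rewrite nE !subSS subn0; eexists.
    exact: (is_deriveM (is_derive_sinX 2 r) (is_derive_half_sin m r)).
  by rewrite /GRing.scale /= sE cE ![_ ^+ m.+1]exprS -!natr1; field.
Qed.

End radial_weight.

Section radial_functions.
Variables (R : realType) (M : crossSpace) (n : nat).
Hypothesis nM : valid_dim M n.
Local Notation leb := (@lebesgue_measure R).
Local Notation w := (@dvol R M n).
Local Notation v := (@vol R M n).
Local Notation a := (@jalpha R n).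
Local Notation b := (@weight_beta R M n).
Local Notation phi := (@phi R M n).
Local Notation eigval := (@eigval R M n).

Lemma dvol_gt0 r : r \in `]0, pi[ -> 0 < w r.
Proof.
rewrite in_itv/= => /andP[r0 rpi].
have s1 : 0 < sin r by apply: sin_gt0_pi; rewrite r0.
have s2 : 0 < sin (r / 2) by apply: sin_gt0_pi; apply/andP; split; lra.
by rewrite /dvol; case: M; rewrite ?mulr_gt0 ?exprn_gt0.
Qed.

Lemma dvol_at0 : w 0 = 0.
Proof.
rewrite /dvol mul0r sin0; case: M nM => /= n2.
- by rewrite expr0n subn_eq0 leqNgt n2.
- by rewrite expr0n subn_eq0 leqNgt n2.
- by rewrite mul0r.
- by rewrite expr0n mul0r.
Qed.

Lemma sin_eq0_dvol_eq0 r : r \in `[0, pi] -> w r = 0 -> sin r = 0.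
Proof.
rewrite in_itv/= => /andP[r0 rpi] wr.
have [->|rn0] := eqVneq r 0; first by rewrite sin0.
have [->|rnpi] := eqVneq r pi; first by rewrite sinpi.
have : 0 < w r by apply: dvol_gt0; rewrite in_itv/= !lt_neqAle r0 rpi rnpi eq_sym rn0.
by rewrite wr ltxx.
Qed.

Lemma vol_le0 r : r <= 0 -> v r = 0.
Proof.
rewrite /vol le_eqVlt => /predU1P[->|r0].
  by rewrite set_itv1 Rintegral_set1.
by rewrite set_itv_ge ?Rintegral_set0// bnd_simp -ltNge.
Qed.

Lemma measurable_vol_line : measurable_fun setT v.
Proof.
apply: measurable_Rintegral_itv => //.
by apply: continuous_measurable; exact: continuous_dvol.
Qed.

(** Since [w] vanishes at [0], extending it by [0] to the left keeps it
    continuous, so that [v] is also differentiable at [0]. *)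
Lemma is_derive_vol (r : R) : 0 <= r -> is_derive r 1 v (w r).
Proof.
move=> r0; pose f x := w (Num.max 0 x).
have cf : continuous f.
  move=> x; apply: (@continuous_comp _ _ _ (fun y : R => Num.max 0 y) w).
    by apply: continuous_max; [exact: cvg_cst|exact: cvg_id].
  exact: continuous_dvol.
have vE : v = fun x => \int[leb]_(s in `[-1, x]) f s.
  apply/funext => x; rewrite /vol Rintegral_mkcond [RHS]Rintegral_mkcond.
  apply: eq_Rintegral => s _; rewrite !patchE !mem_setE !in_itv/= /f.
  have [s0|s0] := leP 0 s.
    by rewrite (le_trans _ s0)// lerN10.
  by rewrite dvol_at0; case: ifP.
have rr1 : r < r + 1 by rewrite ltrDl.
have iw : leb.-integrable `[-1, r + 1] (EFin \o f).
  by apply: continuous_itv_integrable => x _; exact: cf.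
have r1 : -1 < r by apply: lt_le_trans r0; rewrite ltrN10.
have [d1 d2] : derivable v r 1 /\ derive1 v r = f r.
  by rewrite vE; exact: (continuous_FTC1_closed rr1 iw r1 (cf r)).
by apply: DeriveDef; [exact: d1|rewrite -derive1E d2 /f max_r].
Qed.

Lemma continuous_vol (r : R) : 0 <= r -> {for r, continuous v}.
Proof.
move=> /is_derive_vol [dv _].
exact/differentiable_continuous/derivable1_diffP.
Qed.

Lemma vol_gt0 r : 0 < r -> r <= pi -> 0 < v r.
Proof.
move=> r0 rpi; have r2 : r / 2 \in `]0, r[ by rewrite in_itv/=; apply/andP; split; lra.
apply: (@Rintegral_gt0 _ _ _ _ (r / 2)) => //.
- by move=> x _; exact: continuous_dvol.
- move=> x; rewrite in_itv/= => /andP[x0 xr]; apply: dvol_ge0.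
  by rewrite /= in_itv/= x0 (le_trans xr).
- by apply: dvol_gt0; move: r2; rewrite !in_itv/= => /andP[-> /lt_le_trans ->].
Qed.

(** The scalar is [1] except on the real projective space, where it is the
    factor of the quadratic transformation. *)
Definition zonal_poly k : {poly R} :=
  (phi k 0 / (jacobi a b k).[1]) *: jacobi a b k.

Lemma phi0_neq0 k : phi k 0 != 0.
Proof.
have a1 := @jalpha_gtN1 R _ _ nM.
by rewrite /Defs.phi mulr0 cos0; case: M; exact: jacobi_at1_neq0.
Qed.

Let scale_neq0 k : phi k 0 / (jacobi a b k).[1] != 0.
Proof.
rewrite mulf_neq0 ?phi0_neq0 ?invr_eq0//.
exact/jacobi_at1_neq0/(@jalpha_gtN1 R _ _ nM).
Qed.

Lemma phiE k r : phi k r = (zonal_poly k).[cos r].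
Proof.
have a1 := @jalpha_gtN1 R _ _ nM.
have J0 := jacobi_at1_neq0 b k a1.
rewrite /zonal_poly hornerZ /Defs.phi /weight_beta mulr0 cos0.
move: J0; rewrite /weight_beta; case: M => J0; rewrite /jgamma ?mul1r ?divff ?mul1r//.
have [c c0 ->] := jacobi_quadratic k a1.
rewrite !hornerZ !horner_comp.
have E x : (2%:P * 'X ^+ 2 - 1 : {poly R}).[x] = 2 * x ^+ 2 - 1.
  by rewrite !hornerE.
rewrite !E expr1n mulr1 (_ : 2 - 1 = 1); last by ring.
rewrite mulfK// mulrC [2^-1 * r]mulrC.
have -> : 2 * cos (r / 2) ^+ 2 - 1 = cos ((r / 2) *+ 2).
  by rewrite cos_mulr2n; ring.
by rewrite mulrC; congr (_ * _.[cos _]); rewrite mulr2n; field.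
Qed.

Lemma size_zonal_deriv k : size (zonal_poly k.+1)^`() = k.+1.
Proof.
rewrite derivZ size_scale ?scale_neq0//; apply: size_deriv_jacobi.
  exact: (@jalpha_gtN1 R _ _ nM).
exact: weight_sum_gtN1.
Qed.

Lemma zonal_ode k x :
  (1 - x ^+ 2) * ((zonal_poly k)^`()^`()).[x] +
  (b - a - (a + b + 2) * x) * ((zonal_poly k)^`()).[x] =
  eigval k * (zonal_poly k).[x].
Proof.
have := jacobi_ode a b k; rewrite /jacobi_op => /(congr1 (fun p => p.[x])).
rewrite hornerC !(hornerD, hornerN, hornerM, hornerC, hornerX, horner_exp).
rewrite /zonal_poly !derivZ !hornerZ eigval_jacobi.
set P := (jacobi a b k).[x]; set P1 := ((jacobi a b k)^`()).[x].
set P2 := ((jacobi a b k)^`()^`()).[x].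
move=> /eqP; rewrite addr_eq0 => /eqP e.
set c := phi k 0 / _.
transitivity (c * ((1 - x ^+ 2) * P2 + (b - a - (a + b + 2) * x) * P1)); first by ring.
by rewrite e; ring.
Qed.

Definition dphi k r : R := - sin r * ((zonal_poly k)^`()).[cos r].

Lemma is_derive_horner_cos (P : {poly R}) (r : R) :
  is_derive r 1 (fun x : R => P.[cos x]) (- sin r * P^`().[cos r]).
Proof.
rewrite mulrC.
exact: (@is_derive1_comp _ (horner P) (@cos R) r _ _
  (is_derive_poly P (cos r)) (is_derive_cos r)).
Qed.

Lemma is_derive_phi k (r : R) : is_derive r 1 (phi k) (dphi k r).
Proof.
rewrite (_ : phi k = fun x => (zonal_poly k).[cos x]); last first.
  by apply/funext => x; rewrite phiE.
exact: is_derive_horner_cos.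
Qed.

Definition flux k r : R := w r * dphi k r.

(** The Jacobi equation in divergence form. *)
Lemma is_derive_flux k (r : R) : is_derive r 1 (flux k) (eigval k * (phi k r * w r)).
Proof.
have [d dw dE] := is_derive_dvol nM r.
have ds := is_deriveM (is_deriveN (is_derive_sin r))
  (is_derive_horner_cos (zonal_poly k)^`() r).
have := is_deriveM dw ds.
rewrite (_ : w * _ = flux k)// => dF; apply: (is_derive_eq dF).
rewrite /GRing.scale /= !fctE phiE mulrA -zonal_ode.
set P1 := ((zonal_poly k)^`()).[cos r]; set P2 := ((zonal_poly k)^`()^`()).[cos r].
have -> : (1 - cos r ^+ 2) = sin r ^+ 2 by rewrite -(cos2Dsin2 r); ring.
transitivity (- (sin r * d) * P1 + w r * (sin r ^+ 2 * P2 - cos r * P1)); first by ring.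
by rewrite dE; ring.
Qed.

End radial_functions.

(** * Orthogonality of the transported eigenfunctions *)

Section transported_system.
Variables (R : realType) (M : crossSpace) (n : nat).
Hypothesis nM : valid_dim M n.
Local Notation leb := (@lebesgue_measure R).
Local Notation w := (@dvol R M n).
Local Notation v := (@vol R M n).
Local Notation phi := (@phi R M n).
Local Notation dphi := (@dphi R M n).
Local Notation flux := (@flux R M n).
Local Notation eigval := (@eigval R M n).
Local Notation psi := (@link_phi R M n).
Local Notation mu := (@inv_measure_L R M n).
Local Notation tmu := (@inv_measure_Delta R M n).

Lemma ge0_integral_mu (f : R -> \bar R) :
    measurable_fun setT f -> (forall x, (0 <= f x)%E) ->
  (\int[mu]_x f x = \int[leb]_(x in `[0%R, pi]) (f x * (v x ^+ 2 / w x)%:E))%E.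
Proof.
move=> mf f0; apply: (@ge0_integral_density _ (measurableTypeR R) R leb mu
  `[0, pi]%classic (fun x => v x ^+ 2 / w x)) => //.
- exact: measurable_density_L.
- exact: density_L_ge0.
Qed.

Lemma ge0_integral_tmu (f : R -> \bar R) :
    measurable_fun setT f -> (forall x, (0 <= f x)%E) ->
  (\int[tmu]_x f x = \int[leb]_(x in `[0%R, pi]) (f x * (w x)%:E))%E.
Proof.
move=> mf f0; apply: (@ge0_integral_density _ (measurableTypeR R) R leb tmu
  `[0, pi]%classic w) => //.
- exact: measurable_dvol.
- exact: dvol_ge0.
Qed.

Lemma Rintegral_mu (f : R -> R) : measurable_fun setT f ->
  \int[mu]_x f x = \int[leb]_(x in `[0, pi]) (f x * (v x ^+ 2 / w x)).
Proof.
move=> mf; apply: (@Rintegral_density _ (measurableTypeR R) R leb mu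
  `[0, pi]%classic (fun x => v x ^+ 2 / w x)) => //.
- exact: measurable_density_L.
- exact: density_L_ge0.
Qed.

Lemma Rintegral_tmu (f : R -> R) : measurable_fun setT f ->
  \int[tmu]_x f x = \int[leb]_(x in `[0, pi]) (f x * w x).
Proof.
move=> mf; apply: (@Rintegral_density _ (measurableTypeR R) R leb tmu
  `[0, pi]%classic w) => //.
- exact: measurable_dvol.
- exact: dvol_ge0.
Qed.

Lemma ae_mu (P : R -> Prop) :
  {ae leb, forall r, `[0, pi]%classic r -> P r} -> {ae mu, forall r, P r}.
Proof.
apply: (@density_ae_null _ (measurableTypeR R) R leb mu `[0, pi]%classic
  (fun x => v x ^+ 2 / w x)) => //.
exact: measurable_density_L.
Qed.

Let derive_continuous (f : R -> R) (df : R -> R) :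
  (forall x : R, is_derive x 1 f (df x)) -> continuous f.
Proof.
by move=> dF x; have [dx _] := dF x; exact/differentiable_continuous/derivable1_diffP.
Qed.

Lemma continuous_phi k : continuous (phi k).
Proof. exact: (derive_continuous (is_derive_phi nM k)). Qed.

Lemma continuous_dphi k : continuous (dphi k).
Proof.
move=> r; apply: cvgM; last exact: continuous_horner_cos.
by apply: cvgN; exact: continuous_sin.
Qed.

Lemma continuous_flux k : continuous (flux k).
Proof. exact: (derive_continuous (is_derive_flux nM k)). Qed.

Lemma measurable_phi k : measurable_fun setT (phi k).
Proof. by apply: continuous_measurable; exact: continuous_phi. Qed.

Lemma flux_at0 k : flux k 0 = 0.
Proof. by rewrite /flux dvol_at0// mul0r. Qed.

Lemma flux_at_pi k : flux k pi = 0.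
Proof. by rewrite /flux /dphi sinpi oppr0 mul0r mulr0. Qed.

Lemma integral_phi k r : (1 <= k)%N -> 0 <= r ->
  \int[leb]_(s in `[0, r]) (phi k s * w s) = flux k r / eigval k.
Proof.
move=> k1 r0; have l0 := eigval_neq0 R nM k1.
have dF (x : R) : is_derive x 1 (fun x => flux k x / eigval k) (phi k x * w x).
  have := is_deriveZ (eigval k)^-1 (is_derive_flux nM k x).
  rewrite /GRing.scale/= mulKf//.
  by congr is_derive; apply/funext => y; rewrite mulrC.
rewrite (@Rintegral_FTC _ (fun x => flux k x / eigval k)) => [|//|//|x _].
  by rewrite flux_at0 mul0r subr0.
by apply: cvgM; [exact: continuous_phi|exact: continuous_dvol].
Qed.

(** Since [flux k = w * dphi k], this is the image of [dphi k / eigval k] under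
    the multiplication by [w / v], which is isometric from [L^2(w)] to
    [L^2(v ^ 2 / w)]. To the left of [0] both sides vanish with [1 / v]. *)
Lemma link_phiE k r : (1 <= k)%N -> psi k r = flux k r / (eigval k * v r).
Proof.
move=> k1; rewrite /link_phi /link; have [r0|r0] := ltP 0 r.
  by rewrite integral_phi ?ltW// invfM mulrC mulrA.
by rewrite vol_le0// invr0 mul0r mulr0 invr0 mulr0.
Qed.

Lemma measurable_link_phi k : (1 <= k)%N -> measurable_fun setT (psi k).
Proof.
move=> k1; rewrite (_ : psi k = (fun r => flux k r * (eigval k * v r)^-1)); last first.
  by apply/funext => r; rewrite link_phiE.
apply: measurable_funM.
  by apply: continuous_measurable; exact: continuous_flux.
apply: (measurableT_comp (@measurable_inv R)); apply: measurable_funM => //.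
exact: measurable_vol_line.
Qed.

Lemma link_phi_density j k r : (1 <= j)%N -> (1 <= k)%N -> r \in `[0, pi] ->
  psi j r * psi k r * (v r ^+ 2 / w r) =
  (eigval j * eigval k)^-1 * (w r * dphi j r * dphi k r).
Proof.
move=> j1 k1 /[dup] rpi; rewrite in_itv/= => /andP[r0 r1].
rewrite !link_phiE// /flux; have [wr|w0] := eqVneq (w r) 0.
  by rewrite wr !(mul0r, invr0, mulr0).
have v0 : v r != 0.
  move: r0; rewrite le_eqVlt => /predU1P[r0|r0].
    by move: w0; rewrite -r0 dvol_at0 ?eqxx.
  by rewrite gt_eqF// vol_gt0.
by field; rewrite !eigval_neq0// w0 v0.
Qed.

(** Green's formula, by integrating the derivative of [flux j * phi k]; the
    boundary terms vanish because [w] does at [0] and [dphi j] does at [pi]. *)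
Lemma dirichlet_form j k :
  \int[leb]_(r in `[0, pi]) (w r * dphi j r * dphi k r) =
  - eigval j * \int[leb]_(r in `[0, pi]) (phi j r * phi k r * w r).
Proof.
have c1 : continuous (fun r => w r * dphi j r * dphi k r).
  by move=> r; apply: cvgM; [apply: cvgM; [exact: continuous_dvol|
    exact: continuous_dphi]|exact: continuous_dphi].
have c2 : continuous (fun r => phi j r * phi k r * w r).
  by move=> r; apply: cvgM; [apply: cvgM; exact: continuous_phi|
    exact: continuous_dvol].
have c3 : continuous (fun r => eigval j * (phi j r * phi k r * w r)).
  by move=> r; apply: cvgM; [exact: cvg_cst|exact: c2].
have intc (f : R -> R) : continuous f -> leb.-integrable `[0, pi] (EFin \o f).
  by move=> cf; apply: continuous_itv_integrable => x _; exact: cf.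
have dF (r : R) : is_derive r 1 (fun x => flux j x * phi k x)
    (w r * dphi j r * dphi k r + eigval j * (phi j r * phi k r * w r)).
  apply: (is_derive_eq (is_deriveM (is_derive_flux nM j r) (is_derive_phi nM k r))).
  by rewrite /GRing.scale/= /flux; ring.
have := @Rintegral_FTC _ _ _ 0 pi (pi_ge0 R) (fun r _ => dF r) _.
rewrite flux_at0 flux_at_pi !mul0r subrr RintegralD//; [|exact: intc|exact: intc].
rewrite RintegralZl//; last exact: intc.
move=> H; apply/eqP; rewrite mulNr -subr_eq0 opprK; apply/eqP; apply: H => r _.
by apply: cvgD; [exact: c1|exact: c3].
Qed.

Lemma L2dot_phi j k :
  L2dot tmu (phi j) (phi k) = \int[leb]_(r in `[0, pi]) (phi j r * phi k r * w r).
Proof.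
by rewrite /L2dot Rintegral_tmu//; apply: measurable_funM; exact: measurable_phi.
Qed.

Lemma L2dot_link_phi j k : (1 <= j)%N -> (1 <= k)%N ->
  L2dot mu (psi j) (psi k) = - (1 / eigval k) * L2dot tmu (phi j) (phi k).
Proof.
move=> j1 k1; rewrite L2dot_phi /L2dot Rintegral_mu; last first.
  by apply: measurable_funM; exact: measurable_link_phi.
rewrite (@eq_Rintegral _ _ _ leb _
  (fun r => (eigval j * eigval k)^-1 * (w r * dphi j r * dphi k r))).
  rewrite RintegralZl//; last first.
    apply: continuous_itv_integrable => x _; apply: cvgM.
      by apply: cvgM; [exact: continuous_dvol|exact: continuous_dphi].
    exact: continuous_dphi.
  by rewrite dirichlet_form; field; rewrite !eigval_neq0.
by move=> r; rewrite inE => rpi; rewrite link_phi_density.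
Qed.

Lemma link_phi_L2 k : (1 <= k)%N -> psi k \in Lfun mu 2%:E.
Proof.
move=> k1; apply/in_L2P; split; first exact: measurable_link_phi.
rewrite ge0_integral_mu//; last 2 first.
- by apply/measurable_EFinP; apply: measurable_funX; exact: measurable_link_phi.
- by move=> r; rewrite lee_fin sqr_ge0.
under eq_integral => r /[!inE] rpi do rewrite -EFinM expr2 link_phi_density//.
apply: continuous_itv_integral_lty => x _; apply: cvgM; first exact: cvg_cst.
apply: cvgM; last exact: continuous_dphi.
by apply: cvgM; [exact: continuous_dvol|exact: continuous_dphi].
Qed.

Lemma phi_L2 k : phi k \in Lfun tmu 2%:E.
Proof.
apply/in_L2P; split; first exact: measurable_phi.
rewrite ge0_integral_tmu//; last 2 first.
- by apply/measurable_EFinP; apply: measurable_funX; exact: measurable_phi.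
- by move=> r; rewrite lee_fin sqr_ge0.
under eq_integral do rewrite -EFinM.
apply: continuous_itv_integral_lty => x _.
by apply: cvgM; [apply: cvgM; exact: continuous_phi|exact: continuous_dvol].
Qed.

(** [phi k] does not vanish at the pole [r = 0], hence not near it either. *)
Lemma L2dot_phi_gt0 k : 0 < L2dot tmu (phi k) (phi k).
Proof.
have p0 : 0 < `|phi k 0| / 2 by rewrite divr_gt0// normr_gt0 phi0_neq0.
have /cvgrPdist_lt/(_ _ p0)/nbhs_ballP[dl /= dl0 fdl] := @continuous_phi k 0.
pose r := Num.min (dl / 2) 1.
have [r0 rdl r1] : [/\ 0 < r, r <= dl / 2 & r <= 1].
  by rewrite /r lt_min divr_gt0// ltr01 !ge_min !lexx orbT.
have rpi : r \in `]0, pi[ by rewrite in_itv/= r0; have := @pi_ge2 R; lra.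
have phir : phi k r != 0.
  apply/negP => /eqP pr; have : `|phi k 0 - phi k r| < `|phi k 0| / 2.
    by apply: fdl; rewrite /ball/= sub0r normrN gtr0_norm//; lra.
  by rewrite pr subr0; lra.
rewrite L2dot_phi; apply: (@Rintegral_gt0 _ _ _ _ r) => //.
- move=> x _; apply: cvgM; last exact: continuous_dvol.
  by apply: cvgM; exact: continuous_phi.
- by move=> x xpi; rewrite mulr_ge0 ?dvol_ge0// -expr2 sqr_ge0.
- by rewrite mulr_gt0 ?dvol_gt0// -expr2 exprn_even_gt0.
Qed.

Lemma L2norm_link_phi k : (1 <= k)%N ->
  L2norm mu (psi k) ^+ 2 = - (1 / eigval k) * L2norm tmu (phi k) ^+ 2.
Proof.
by move=> k1; rewrite !L2norm_sq ?link_phi_L2 ?phi_L2// L2dot_link_phi.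
Qed.

Lemma L2norm_link_phi_neq0 k : (1 <= k)%N -> L2norm mu (psi k) != 0.
Proof.
move=> k1; rewrite -sqrf_eq0 L2norm_link_phi// L2norm_sq ?phi_L2//.
rewrite mulf_neq0 ?oppr_eq0 ?mul1r ?invr_eq0 ?eigval_neq0//.
by rewrite gt_eqF// L2dot_phi_gt0.
Qed.

Lemma orthogonal_link_phi : orthogonal_system mu (fun k => psi k.+1).
Proof.
split=> [k|k|j k jk]; [exact: link_phi_L2|exact: L2norm_link_phi_neq0|].
have := L2dot_link_phi (ltn0Sn j) (ltn0Sn k).
rewrite [in X in X -> _]L2dotC.
have := L2dot_link_phi (ltn0Sn k) (ltn0Sn j).
move=> e1 e2; have lj := eigval_neq0 R nM (ltn0Sn j).
have lk := eigval_neq0 R nM (ltn0Sn k).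
rewrite L2dotC.
have e3 : (eigval j.+1 - eigval k.+1) * L2dot mu (psi k.+1) (psi j.+1) = 0.
  rewrite mulrBl {1}e1 e2 (L2dotC tmu (phi j.+1)); field.
  by rewrite lj lk.
apply/eqP; move/eqP: e3; rewrite mulf_eq0 => /orP[|//].
by rewrite subr_eq0 => /eqP /(eigval_inj nM) [jk']; rewrite jk' eqxx in jk.
Qed.

End transported_system.

(** * Completeness *)

Lemma poly_span (F : fieldType) (p : nat -> {poly F}) (N : nat) (Q : {poly F}) :
  (forall k, size (p k) = k.+1) -> (size Q <= N)%N ->
  exists d : nat -> F, Q = \sum_(k < N) d k *: p k.
Proof.
move=> sp; elim: N Q => [|N IH] Q sQ.
  exists (fun=> 0); rewrite big_ord0; apply/eqP.
  by rewrite -size_poly_eq0 -leqn0.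
pose c := Q`_N / (p N)`_N.
have pN0 : (p N)`_N != 0.
  by have := lead_coef_eq0 (p N); rewrite lead_coefE sp /= -size_poly_eq0 sp => ->.
have [|d dE] := IH (Q - c *: p N).
  apply/leq_sizeP => j; rewrite leq_eqVlt coefB coefZ => /predU1P[<-|Nj].
    by rewrite /c divfK// subrr.
  by rewrite !nth_default ?sp// ?mulr0 ?subr0//; exact: leq_trans Nj.
exists (fun k => if (k < N)%N then d k else c).
rewrite big_ord_recr/= ltnn -[LHS](subrK (c *: p N)) dE.
by congr (_ + _); apply: eq_bigr => k _; rewrite ltn_ord.
Qed.

Section completeness.
Variables (R : realType) (M : crossSpace) (n : nat).
Hypothesis nM : valid_dim M n.
Local Notation leb := (@lebesgue_measure R).
Local Notation w := (@dvol R M n).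
Local Notation v := (@vol R M n).
Local Notation eigval := (@eigval R M n).
Local Notation psi := (@link_phi R M n).
Local Notation mu := (@inv_measure_L R M n).

Lemma dvol_le1 r : r \in `[0, pi] -> w r <= 1.
Proof.
rewrite in_itv/= => /andP[r0 rpi].
have s1 : 0 <= sin r <= 1.
  by rewrite sin_le1 andbT; apply: sin_ge0_pi; rewrite r0.
have s2 : 0 <= sin (r / 2) <= 1.
  by rewrite sin_le1 andbT; apply: sin_ge0_pi; apply/andP; split; lra.
case/andP: s1 => s10 s11; case/andP: s2 => s20 s21.
rewrite /dvol; case: M; rewrite ?exprn_ile1//.
  by rewrite mulr_ile1 ?exprn_ge0 ?exprn_ile1.
by rewrite mulr_ile1 ?exprn_ge0 ?exprn_ile1.
Qed.

(** The derivatives of the [zonal_poly k.+1] have all the degrees [k], hence span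
    the polynomials. *)
Lemma link_phi_span (Q : {poly R}) : exists c : nat -> R, forall r,
  w r / v r * (sin r * Q.[cos r]) = \sum_(k < size Q) c k * psi k.+1 r.
Proof.
have [d dE] := poly_span (size_zonal_deriv R nM) (leqnn (size Q)).
exists (fun k => - eigval k.+1 * d k) => r.
rewrite {1}dE horner_sum !mulr_sumr; apply: eq_bigr => k _.
rewrite hornerZ link_phiE// /flux /dphi invfM.
have lk := eigval_neq0 R nM (ltn0Sn k).
rewrite -[LHS]mul1r -(mulfV lk); ring.
Qed.

Let sqr_density r (g s : R) : r \in `[0, pi] -> w r != 0 ->
  (g - w r / v r * s) ^+ 2 * (v r ^+ 2 / w r) = (g * v r / w r - s) ^+ 2 * w r.
Proof.
rewrite in_itv/= => /andP[r0 rpi] w0.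
have v0 : v r != 0.
  move: r0; rewrite le_eqVlt => /predU1P[r0|r0].
    by move: w0; rewrite -r0 dvol_at0 ?eqxx.
  by rewrite gt_eqF// vol_gt0.
by field; rewrite w0 v0.
Qed.

(** Multiplication by [v / w] turns [g] into [F] in [L^2(w)], to be approximated
    by functions [sin r * Q (cos r)]. Up to a small error [F] is supported where
    [`|F| <= m * sin r]; there [F / sin] is bounded and is approximated by a
    polynomial in the cosine. *)
Lemma complete_link_phi : complete_system mu (fun k => psi k.+1).
Proof.
move=> g gL eps eps0; have mg := L2_measurable gL.
have mw : measurable_fun setT w.
  by apply: continuous_measurable; exact: continuous_dvol.
have mv : measurable_fun setT v by exact: measurable_vol_line.
pose F r := g r * v r / w r.
have mF : measurable_fun setT F.
  apply: measurable_funM; first exact: measurable_funM.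
  exact: (measurableT_comp (@measurable_inv R) mw).
have mFw : measurable_fun setT (fun r => F r ^+ 2 * w r).
  by apply: measurable_funM => //; exact: measurable_funX.
have Fw0 r : r \in `[0, pi] -> 0 <= F r ^+ 2 * w r.
  by move=> rpi; apply: mulr_ge0; [exact: sqr_ge0|exact: dvol_ge0].
have iF : leb.-integrable `[0, pi] (EFin \o (fun r => F r ^+ 2 * w r)).
  apply/integrableP; split; first by apply/measurable_EFinP; exact: measurable_funTS.
  have [_] := (in_L2P mu g).1 gL; rewrite ge0_integral_mu//; last 2 first.
  - by apply/measurable_EFinP; exact: measurable_funX.
  - by move=> r; rewrite lee_fin sqr_ge0.
  apply: le_lt_trans; rewrite le_eqVlt; apply/orP; left; apply/eqP.
  apply: eq_integral => r; rewrite inE => rpi /=.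
  rewrite ger0_norm ?Fw0// -EFinM; congr EFin.
  have [w0|w0] := eqVneq (w r) 0; first by rewrite w0 invr0 !mulr0.
  by have := sqr_density (g r) 0 rpi w0; rewrite mulr0 !subr0 => <-.
have sinM : measurable_fun setT (@sin R).
  by apply: continuous_measurable; exact: continuous_sin.
have mA (m : nat) : measurable_fun setT (fun r => `|F r| <= m%:R * sin r).
  apply: measurable_fun_ler; first exact: measurableT_comp.
  exact: measurable_funM.
pose f_ (m : nat) r := if `|F r| <= m%:R * sin r then 0 else F r ^+ 2 * w r.
have mf_ m : measurable_fun setT (f_ m) by exact: measurable_fun_ifT.
have f_ge0 m r : r \in `[0, pi] -> 0 <= f_ m r.
  by move=> rpi; rewrite /f_; case: ifP => // _; exact: Fw0.
have e4 : 0 < eps ^+ 2 / 4 by rewrite divr_gt0 ?exprn_gt0.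
have [m fm] : exists m,
    (\int[leb]_(r in `[0%R, pi]) (f_ m r)%:E < (eps ^+ 2 / 4)%:E)%E.
  have ae0 : {ae leb, forall r, `[0, pi]%classic r ->
      (EFin \o f_ m) r @[m --> \oo] --> (EFin \o cst 0) r}.
    apply: ae_segment => r; rewrite in_itv/= => r0pi.
    have s0 : 0 < sin r by exact: sin_gt0_pi.
    apply: cvg_EFin; first exact: nearW.
    apply: cvg_near_cst; near=> m; rewrite /= /f_ ifT//.
    rewrite -ler_pdivrMr//; near: m; exact: nbhs_infty_ger.
  have bound : {ae leb, forall r m, `[0, pi]%classic r ->
      (`|(EFin \o f_ m) r| <= (EFin \o (fun r => F r ^+ 2 * w r)%R) r)%E}.
    apply: nearW => r m rpi /=; rewrite lee_fin ger0_norm ?f_ge0// /f_.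
    by case: ifP => // _; exact: Fw0.
  have mf m : measurable_fun `[0%R, pi] (EFin \o f_ m).
    by apply/measurable_EFinP; exact: (measurable_funTS (mf_ m)).
  have m0 : measurable_fun `[0%R, pi] (EFin \o (cst 0 : R -> R))
    by apply/measurable_EFinP; exact: measurable_cst.
  have [_ _] := @dominated_convergence _ _ _ leb _ (measurable_itv _) _ _ _ mf m0
    ae0 iF bound.
  rewrite integral0 => /fine_cvgP[fin /cvgrPdist_lt/(_ _ e4) c].
  near \oo => m; exists m.
  have mfin : (\int[leb]_(r in `[0%R, pi]) (EFin \o f_ m) r)%E \is a fin_num.
    by near: m.
  rewrite -(fineK mfin) lte_fin; apply: le_lt_trans (ler_norm _) _.
  by rewrite -normrN -sub0r; near: m; exact: c.
pose h r := if `|F r| <= m%:R * sin r then F r / sin r else 0.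
have mh : measurable_fun setT h.
  apply: measurable_fun_ifT => //; apply: measurable_funM => //.
  exact: (measurableT_comp (@measurable_inv R) sinM).
have hm r : `|h r| <= m%:R.
  rewrite /h; case: ifP => [Fm|_]; last by rewrite normr0.
  have [s0|s0] := eqVneq (sin r) 0; first by rewrite s0 invr0 mulr0 normr0.
  have sge : 0 <= m%:R * sin r by exact: le_trans Fm.
  have [sp|sn] := ltP 0 (sin r).
    by rewrite normrM normfV (gtr0_norm sp) ler_pdivrMr.
  have -> : F r = 0.
    apply/eqP; rewrite -normr_le0 (le_trans Fm)//.
    by rewrite mulr_ge0_le0.
  by rewrite mul0r normr0.
(* The squared distance will be at most
   [2 * (eps ^ 2 / 4) + 4 * m * (eps ^ 2 / (8 * (m + 1)))]. *)
have e' : 0 < eps ^+ 2 / (8 * m.+1%:R) by rewrite divr_gt0 ?exprn_gt0// mulr_gt0.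
have [Q Qm Qh] := cos_polynomial_approx mh hm e'.
have [c cE] := link_phi_span Q.
exists (size Q), c.
pose S r := w r / v r * (sin r * Q.[cos r]).
have SE : (fun r => g r - \sum_(k < size Q) c k * psi k.+1 r) = (fun r => g r - S r).
  by apply/funext => r; rewrite -cE.
have DL : (fun r => g r - S r) \in Lfun mu 2%:E.
  rewrite -SE; apply: L2_sub => //.
  by apply: (@L2_sum _ _ _ mu (size Q) c (fun k => psi k.+1)) => k; exact: link_phi_L2.
rewrite SE L2normE// lte_fin -(@ltr_pXn2r _ 2) ?nnegrE ?L2norm_ge0 ?(ltW eps0)//.
rewrite -lte_fin EFin_L2norm_sq// ge0_integral_mu//; last 2 first.
- by apply/measurable_EFinP; apply: measurable_funX; exact: L2_measurable DL.
- by move=> r; rewrite lee_fin sqr_ge0.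
have mS : measurable_fun setT S.
  have := measurable_funB mg (L2_measurable DL).
  by congr measurable_fun; apply/funext => r /=; rewrite opprB addrCA subrr addr0.
have mhQ : measurable_fun setT (fun r => `|h r - Q.[cos r]|).
  apply: measurableT_comp => //; apply: measurable_funB => //.
  by apply: continuous_measurable; exact: continuous_horner_cos.
have bound r : r \in `[0, pi] -> (g r - S r) ^+ 2 * (v r ^+ 2 / w r) <=
    2 * f_ m r + 4 * m%:R * `|h r - Q.[cos r]|.
  move=> rpi; have := f_ge0 m r rpi; have := dvol_le1 rpi.
  have m0 : 0 <= m%:R :> R by [].
  have [w0|w0] := eqVneq (w r) 0.
    by move=> _ ?; rewrite w0 invr0 !mulr0 addr_ge0 ?mulr_ge0.
  move=> w1 _; rewrite sqr_density// -/(F r).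
  have wp : 0 < w r by rewrite lt_neqAle eq_sym w0 dvol_ge0.
  have s1 : sin r ^+ 2 <= 1 by rewrite -(cos2Dsin2 r) lerDr sqr_ge0.
  have dist_sq x y : `|x| <= m%:R -> `|y| <= m%:R ->
      sin r ^+ 2 * (x - y) ^+ 2 * w r <= 2 * m%:R * `|x - y|.
    move=> xm ym; apply: (@le_trans _ _ ((x - y) ^+ 2)).
      rewrite mulrAC -[leRHS]mul1r ler_wpM2r ?sqr_ge0// mulr_ile1 ?sqr_ge0//.
      exact: ltW.
    rewrite -(real_normK (num_real _)) expr2 ler_wpM2r//.
    by rewrite (le_trans (ler_normB _ _))// mulr_natl mulr2n lerD.
  have hQ := dist_sq _ _ (hm r) (Qm r).
  have hQ0 : 0 <= m%:R * `|h r - Q.[cos r]| by rewrite mulr_ge0.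
  move: hQ hQ0; rewrite /f_ /h; case: ifPn => [Fm|_].
    have -> : F r = sin r * (F r / sin r).
      have [s0|s0] := eqVneq (sin r) 0; last by rewrite mulrC divfK.
      by rewrite s0 mul0r; apply/eqP; rewrite -normr_le0 (le_trans Fm)// s0 mulr0.
    rewrite -mulrBr exprMn !(mulrC (sin r)) => + +.
    have [s0|s0] := eqVneq (sin r) 0; last first.
      by rewrite mulfK//; lra.
    by rewrite s0 !(mul0r, mulr0, invr0); lra.
  rewrite sub0r normrN sqrrN => hQ hQ0.
  have := sqr_ge0 (F r + sin r * Q.[cos r]); nra.
have mf' : measurable_fun `[0%R, pi] (fun r => (f_ m r)%:E).
  by apply/measurable_EFinP; exact: (measurable_funTS (mf_ m)).
have mhQ' : measurable_fun `[0%R, pi] (fun r => (`|h r - Q.[cos r]|)%:E).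
  by apply/measurable_EFinP; exact: (measurable_funTS mhQ).
have mD : measurable_fun `[0%R, pi]
    (fun r => ((g r - S r) ^+ 2)%:E * (v r ^+ 2 / w r)%:E)%E.
  apply: emeasurable_funM; apply/measurable_EFinP; last exact: measurable_density_L.
  by apply: measurable_funTS; apply: measurable_funX; exact: (L2_measurable DL).
have fm0 r : `[0, pi]%classic r -> (0 <= 2%:E * (f_ m r)%:E)%E.
  by move=> rpi; rewrite -EFinM lee_fin mulr_ge0// f_ge0.
have hQ0 r : `[0, pi]%classic r ->
    (0 <= (4 * m%:R)%:E * (`|h r - Q.[cos r]|)%:E)%E.
  by move=> rpi; rewrite -EFinM lee_fin !mulr_ge0.
apply: (@le_lt_trans _ _ (\int[leb]_(r in `[0%R, pi])
    (2%:E * (f_ m r)%:E + (4 * m%:R)%:E * (`|h r - Q.[cos r]|)%:E))%E).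
  apply: ge0_le_integral => //.
  - by move=> r rpi; rewrite -EFinM lee_fin mulr_ge0 ?sqr_ge0// density_L_ge0.
  - by apply: emeasurable_funD; apply: emeasurable_funM.
rewrite ge0_integralD//; [|exact: emeasurable_funM|exact: emeasurable_funM].
rewrite !ge0_integralZl_EFin//; last by move=> r rpi; rewrite lee_fin f_ge0.
apply: (@lt_le_trans _ _ ((2 * (eps ^+ 2 / 4))%:E +
    (4 * m.+1%:R * (eps ^+ 2 / (8 * m.+1%:R)))%:E)%E); last first.
  rewrite -EFinD lee_fin le_eqVlt; apply/orP; left; apply/eqP.
  have : m.+1%:R != 0 :> R by rewrite pnatr_eq0.
  by move: (m.+1%:R : R) => y y0; field.
apply: lteD; first by rewrite EFinM lte_pmul2l.
rewrite [ltRHS]EFinM; apply: (@le_lt_trans _ _ ((4 * m.+1%:R)%:E *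
    \int[leb]_(r in `[0%R, pi]) (`|h r - Q.[cos r]|)%:E)%E).
  apply: lee_wpmul2r; first exact: integral_ge0.
  by rewrite lee_fin ler_wpM2l// ler_nat.
by rewrite lte_pmul2l// lte_fin mulr_gt0.
Unshelve. all: by end_near. Qed.

End completeness.

(** * The Green operator *)

Section green_operator.
Variables (R : realType) (M : crossSpace) (n : nat).
Hypothesis nM : valid_dim M n.
Local Notation leb := (@lebesgue_measure R).
Local Notation w := (@dvol R M n).
Local Notation v := (@vol R M n).
Local Notation phi := (@phi R M n).
Local Notation dphi := (@dphi R M n).
Local Notation flux := (@flux R M n).
Local Notation eigval := (@eigval R M n).
Local Notation psi := (@link_phi R M n).
Local Notation mu := (@inv_measure_L R M n).
Local Notation green := (@green R M n).

Definition primitive_mu (g : R -> R) (t : R) : R :=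
  \int[leb]_(s in `[0, t]) (v s ^+ 2 / w s * g s).

Lemma measurable_dvol_line : measurable_fun setT w.
Proof. by apply: continuous_measurable; exact: continuous_dvol. Qed.

Lemma measurable_density_line : measurable_fun setT (fun s => v s ^+ 2 / w s).
Proof.
apply: measurable_funM; first by apply: measurable_funX; exact: measurable_vol_line.
exact: (measurableT_comp (@measurable_inv R) measurable_dvol_line).
Qed.

Lemma measurable_codensity : measurable_fun setT (fun t => w t / v t ^+ 2).
Proof.
apply: measurable_funM; first exact: measurable_dvol_line.
apply: (measurableT_comp (@measurable_inv R)).
by apply: measurable_funX; exact: measurable_vol_line.
Qed.

Lemma measurable_primitive_mu g : measurable_fun setT g ->
  measurable_fun setT (primitive_mu g).
Proof.
move=> mg; apply: measurable_Rintegral_itv => //.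
by apply: measurable_funM => //; exact: measurable_density_line.
Qed.

Lemma measurable_green g : measurable_fun setT g -> measurable_fun setT (green g).
Proof.
move=> mg; apply: measurable_Rintegral_itv => //.
apply: measurable_funM; first exact: measurable_codensity.
exact: measurable_primitive_mu.
Qed.

Lemma vol_neq0 r : 0 < r -> r <= pi -> v r != 0.
Proof. by move=> r0 rpi; rewrite gt_eqF// vol_gt0. Qed.

(** Both sides have derivative [v * dphi k / eigval k]: on the right [w * phi k]
    cancels between the two terms. *)
Lemma primitive_link_phi k t : (1 <= k)%N -> t \in `[0, pi] ->
  primitive_mu (psi k) t = (v t * phi k t - flux k t / eigval k) / eigval k.
Proof.
rewrite in_itv/= => k1 /andP[t0 tpi]; have lk := eigval_neq0 R nM k1.
have E s : s \in `[0, pi] -> v s ^+ 2 / w s * psi k s = v s * dphi k s / eigval k.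
  move=> spi; rewrite link_phiE// /flux; have [w0|w0] := eqVneq (w s) 0.
    by rewrite /dphi (sin_eq0_dvol_eq0 spi w0) w0 oppr0 !(mul0r, mulr0).
  have [v0|v0] := eqVneq (v s) 0; first by rewrite v0 !(mul0r, mulr0, expr0n).
  by field; rewrite lk w0 v0.
transitivity (\int[leb]_(s in `[0, t]) (v s * dphi k s / eigval k)).
  apply: eq_Rintegral => s; rewrite inE /= in_itv/= => /andP[s0 st].
  by rewrite E// in_itv/= s0 (le_trans st).
pose F x := (v x * phi k x - flux k x / eigval k) / eigval k.
rewrite (@Rintegral_FTC _ F)//.
- by rewrite /F flux_at0// (vol_le0 _ _ (lexx 0)) !mul0r subrr mul0r subr0.
- move=> x; rewrite in_itv/= => /andP[x0 _].
  have d1 := is_deriveM (is_derive_vol nM x0) (is_derive_phi nM k x).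
  have d2 := is_deriveZ (eigval k)^-1 (is_derive_flux nM k x).
  have d3 := is_deriveZ (eigval k)^-1 (is_deriveB d1 d2).
  rewrite (_ : F = (eigval k)^-1 \*: (v * phi k - (eigval k)^-1 \*: flux k)).
    by apply: (is_derive_eq d3); rewrite /GRing.scale/=; field.
  apply/funext => y; rewrite /F.
  rewrite -[RHS]/((eigval k)^-1 * (v y * phi k y - (eigval k)^-1 * flux k y)).
  by ring.
- move=> x; rewrite in_itv/= => /andP[x0 _].
  apply: cvgM; last exact: cvg_cst.
  by apply: cvgM; [exact: continuous_vol|exact: continuous_dphi].
Qed.

Let continuous_p_primitive k (t : R) : 0 < t -> t <= pi ->
  {for t, continuous (fun t => w t / v t ^+ 2 *
    ((v t * phi k t - flux k t / eigval k) / eigval k))}.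
Proof.
move=> t0 tpi; have vt : v t ^+ 2 != 0 by rewrite expf_neq0// vol_neq0.
have cv : {for t, continuous v} by apply: continuous_vol => //; exact: ltW.
apply: cvgM.
  apply: cvgM; first exact: continuous_dvol.
  apply: cvgV => //; by rewrite expr2; apply: cvgM.
apply: cvgM; last exact: cvg_cst.
apply: cvgB; first by apply: cvgM => //; exact: continuous_phi.
by apply: cvgM; [exact: continuous_flux|exact: cvg_cst].
Qed.

Let p_primitiveE k r t : (1 <= k)%N -> 0 < r -> t \in `[r, pi] ->
  w t / v t ^+ 2 * primitive_mu (psi k) t =
  w t / v t ^+ 2 * ((v t * phi k t - flux k t / eigval k) / eigval k).
Proof.
move=> k1 r0; rewrite in_itv/= => /andP[rt tpi].
by rewrite primitive_link_phi// in_itv/= tpi andbT ltW// (lt_le_trans r0).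
Qed.

Lemma integrable_codensity_primitive k r : (1 <= k)%N -> 0 < r ->
  leb.-integrable `[r, pi]
    (EFin \o (fun t => w t / v t ^+ 2 * primitive_mu (psi k) t)).
Proof.
move=> k1 r0; apply: (@eq_integrable _ _ _ leb _ (measurable_itv _) (EFin \o (fun t =>
    w t / v t ^+ 2 * ((v t * phi k t - flux k t / eigval k) / eigval k)))).
  by move=> t; rewrite inE/= => trpi; rewrite (p_primitiveE k1 r0 trpi).
apply: continuous_itv_integrable => t; rewrite in_itv/= => /andP[rt tpi].
by apply: continuous_p_primitive => //; exact: lt_le_trans rt.
Qed.

(** The integrand of the outer integral is the derivative of
    [psi k / eigval k], which vanishes at [pi]. *)
Lemma green_link_phi k r : (1 <= k)%N -> 0 < r -> r <= pi ->
  green (psi k) r = - (1 / eigval k) * psi k r.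
Proof.
move=> k1 r0 rpi; have lk := eigval_neq0 R nM k1.
transitivity (\int[leb]_(t in `[r, pi]) (w t / v t ^+ 2 *
    ((v t * phi k t - flux k t / eigval k) / eigval k))).
  by apply: eq_Rintegral => t; rewrite inE /= => /(p_primitiveE k1 r0).
pose F x := flux k x / (eigval k * v x) / eigval k.
rewrite (@Rintegral_FTC _ F)//.
- by rewrite /F flux_at_pi !mul0r sub0r link_phiE//; field; rewrite lk vol_neq0.
- move=> x; rewrite in_itv/= => /andP[rx xpi].
  have x0 : 0 < x by exact: lt_le_trans rx.
  have vx := vol_neq0 x0 xpi.
  have d1 := is_derive_flux nM k x.
  have d2 := is_deriveV vx (is_derive_vol nM (ltW x0)).
  have d3 := is_deriveZ (eigval k ^- 2) (is_deriveM d1 d2).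
  rewrite (_ : F = eigval k ^- 2 \*: (flux k * (fun y => (v y)^-1))).
    by apply: (is_derive_eq d3); rewrite /GRing.scale/=; field; rewrite lk vx.
  apply/funext => y; rewrite /F invfM.
  rewrite -[RHS]/(eigval k ^- 2 * (flux k y * (v y)^-1)) -exprVn; ring.
- move=> x; rewrite in_itv/= => /andP[rx xpi].
  by apply: continuous_p_primitive => //; exact: lt_le_trans rx.
Qed.

End green_operator.

Section green_bounded.
Variables (R : realType) (M : crossSpace) (n : nat).
Hypothesis nM : valid_dim M n.
Local Notation leb := (@lebesgue_measure R).
Local Notation w := (@dvol R M n).
Local Notation v := (@vol R M n).
Local Notation dphi := (@dphi R M n).
Local Notation flux := (@flux R M n).
Local Notation eigval := (@eigval R M n).
Local Notation psi := (@link_phi R M n).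
Local Notation mu := (@inv_measure_L R M n).
Local Notation green := (@green R M n).
Local Notation primitive_mu := (@primitive_mu R M n).
Implicit Types (f g h : R -> R).

(** The weights of the Schur test are restricted to the open interval, because
    at [pi] the positive eigenfunction vanishes while the weights need not. *)
Definition cut f (r : R) : R := if r \in `]0, pi[ then f r else 0.

Lemma measurable_cut f : measurable_fun setT f -> measurable_fun setT (cut f).
Proof.
move=> mf; apply: measurable_fun_ifT => //.
under eq_fun do rewrite in_itv/=.
by apply: measurable_and; apply: measurable_fun_ltr.
Qed.

Lemma cut_ge0 f : {in `]0, pi[, forall r, 0 <= f r} -> forall r, 0 <= cut f r.
Proof. by move=> f0 r; rewrite /cut; case: ifPn => // /f0. Qed.

Lemma cut_neq0 f r : cut f r != 0 -> r \in `]0, pi[.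
Proof. by rewrite /cut; case: ifP => //; rewrite eqxx. Qed.

Lemma cutE f r : r \in `]0, pi[ -> cut f r = f r.
Proof. by rewrite /cut => ->. Qed.

Let q s := v s ^+ 2 / w s.
Let p t := w t / v t ^+ 2.

Let mq : measurable_fun setT q. Proof. exact: measurable_density_line. Qed.
Let mp : measurable_fun setT p. Proof. exact: measurable_codensity. Qed.

Let q_gt0 r : r \in `]0, pi[ -> 0 < q r.
Proof.
move=> rpi; rewrite divr_gt0 ?dvol_gt0// exprn_gt0//.
by move: rpi; rewrite in_itv/= => /andP[r0 r1]; rewrite vol_gt0// ltW.
Qed.

Let p_gt0 r : r \in `]0, pi[ -> 0 < p r.
Proof.
move=> rpi; rewrite divr_gt0 ?dvol_gt0// exprn_gt0//.
by move: rpi; rewrite in_itv/= => /andP[r0 r1]; rewrite vol_gt0// ltW.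
Qed.

(** [psi 1] up to a nonzero constant factor, which makes its sign explicit. *)
Let u r := w r * sin r / v r.

Let u_gt0 r : r \in `]0, pi[ -> 0 < u r.
Proof.
move=> /[dup] rpi; rewrite in_itv/= => /andP[r0 r1].
by rewrite divr_gt0 ?vol_gt0 ?(ltW r1)// mulr_gt0 ?dvol_gt0// sin_gt0_pi// r0.
Qed.

Let kappa_ex : exists2 kappa : R, kappa != 0 & forall r, u r = kappa * psi 1 r.
Proof.
have /eqP/size_poly1P[d d0 dE] := size_zonal_deriv R nM 0.
have l0 := eigval_neq0 R nM (leqnn 1).
exists (- eigval 1 / d) => [|r]; first by rewrite mulf_neq0 ?oppr_eq0 ?invr_eq0.
rewrite link_phiE// /flux /dphi dE hornerC /u invfM.
have -> : - eigval 1 / d * (w r * (- sin r * d) * ((eigval 1)^-1 * (v r)^-1)) =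
   (eigval 1 / eigval 1) * (d / d) * (w r * sin r / v r) by ring.
by rewrite !divff// !mul1r.
Qed.

Let V t := \int[leb]_(s in `[0, t]) (v s * sin s).

Let q_u s : s \in `[0, pi] -> q s * u s = v s * sin s.
Proof.
move=> spi; rewrite /q /u; have [w0|w0] := eqVneq (w s) 0.
  by rewrite (sin_eq0_dvol_eq0 spi w0) w0 !(mulr0, mul0r, invr0).
have [v0|v0] := eqVneq (v s) 0; first by rewrite v0 expr0n/= !(mulr0, mul0r, invr0).
by field; rewrite w0 v0.
Qed.

Let continuous_vsin (s : R) : 0 <= s -> {for s, continuous (fun s => v s * sin s)}.
Proof.
by move=> s0; apply: cvgM; [exact: continuous_vol|exact: continuous_sin].
Qed.

Let mu_ : measurable_fun setT u.
Proof.
rewrite /u; apply: measurable_funM; last first.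
  apply: (measurableT_comp (@measurable_inv R)); exact: measurable_vol_line.
apply: measurable_funM; first exact: measurable_dvol_line.
by apply: continuous_measurable; exact: continuous_sin.
Qed.

Let mV : measurable_fun setT V.
Proof.
apply: measurable_Rintegral_itv => //; apply: measurable_funM.
  exact: measurable_vol_line.
by apply: continuous_measurable; exact: continuous_sin.
Qed.

Let V_gt0 t : t \in `]0, pi[ -> 0 < V t.
Proof.
rewrite in_itv/= => /andP[t0 tpi].
have vs s : 0 < s -> s < pi -> 0 < v s * sin s.
  by move=> s0 spi; rewrite mulr_gt0 ?vol_gt0 ?(ltW spi)// sin_gt0_pi// s0.
apply: (@Rintegral_gt0 _ _ _ _ (t / 2)) => [s|s||].
- by rewrite in_itv/= => /andP[s0 _]; exact: continuous_vsin.
- rewrite in_itv/= le_eqVlt => /andP[/predU1P[<-|s0] st].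
    by rewrite sin0 mulr0.
  by rewrite ltW// vs// (le_lt_trans st).
- by rewrite in_itv/=; apply/andP; split; lra.
- by apply: vs; lra.
Qed.

Let integrable_vsin t : t \in `[0, pi] ->
  leb.-integrable `[0, t] (EFin \o (fun s => v s * sin s)).
Proof.
move=> _; apply: continuous_itv_integrable => s; rewrite in_itv/= => /andP[s0 _].
exact: continuous_vsin.
Qed.

Let c := - (1 / eigval 1).

Let c_gt0 : 0 < c.
Proof. by rewrite /c oppr_gt0 div1r invr_lt0 eigval_lt0. Qed.

Let V_eq : exists2 kappa : R, forall r, u r = kappa * psi 1 r &
  forall t, t \in `[0, pi] -> V t = kappa * primitive_mu (psi 1) t.
Proof.
have [kappa k0 uE] := kappa_ex; exists kappa => // t tpi.
apply: (mulfI (invr_neq0 k0)); rewrite mulKf// /V -RintegralZl//; last first.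
  exact: integrable_vsin.
apply: eq_Rintegral => s; rewrite inE/= in_itv/= => /andP[s0 st].
rewrite -q_u ?uE ?in_itv/= ?s0//; first by rewrite mulrCA mulKf.
by move: tpi; rewrite in_itv/= => /andP[_ /(le_trans st)].
Qed.

(** As [V] is the inner integral of [u] in the Green operator, this says that
    [u] is an eigenfunction for the eigenvalue [c]. *)
Let outer_V r : r \in `]0, pi[ ->
  (\int[leb]_(t in `[r, pi]) (p t * V t)%:E = (c * u r)%:E)%E.
Proof.
rewrite in_itv/= => /andP[r0 rpi]; have [kappa uE VE] := V_eq.
have ip := integrable_codensity_primitive nM (leqnn 1) r0.
have E t : t \in `[r, pi] -> p t * V t = kappa * (p t * primitive_mu (psi 1) t).
  rewrite in_itv/= => /andP[rt tpi].
  by rewrite VE ?in_itv/= ?tpi ?andbT ?(le_trans (ltW r0))// mulrCA.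
transitivity ((kappa * green (psi 1) r)%:E)%E.
  rewrite EFinM /Defs.green /Rintegral fineK; last exact: integrable_fin_num.
  rewrite -integralZl//; apply: eq_integral => t; rewrite inE/= => /E ->.
  by rewrite EFinM.
by rewrite green_link_phi ?ltW// uE /c mulrCA.
Qed.

Definition below (s t : R) : R := if s <= t then 1 else 0.

Let K_ge0 s t : 0 <= below s t. Proof. by rewrite /below; case: ifP. Qed.

Let mbelow : measurable_fun setT (fun z : R * R => below z.1 z.2).
Proof.
by apply: measurable_fun_ifT => //; apply: measurable_fun_ler.
Qed.

Let mbelow' : measurable_fun setT (fun z : R * R => below z.2 z.1).
Proof.
by apply: measurable_fun_ifT => //; apply: measurable_fun_ler.
Qed.

Let inner (h : R -> R) (t : R) : \bar R :=
  (\int[leb]_s (below s t * (cut q s * h s))%:E)%E.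

Let outer (f : R -> R) (r : R) : \bar R :=
  (\int[leb]_t (below r t * (cut p t * f t))%:E)%E.

Let q_at0 : q 0 = 0.
Proof. by rewrite /q (vol_le0 _ _ (lexx 0)) expr0n mul0r. Qed.

Let innerE h t : t \in `]0, pi[ ->
  inner h t = (\int[leb]_(s in `[0%R, t]) (q s * h s)%:E)%E.
Proof.
rewrite in_itv/= => /andP[t0 tpi]; rewrite [RHS]integral_mkcond.
apply: eq_integral => s _; rewrite patchE mem_setE in_itv/= /below /cut in_itv/=.
have [s0|s0|<-] := ltrgtP 0 s.
- have [st|st] := leP s t; last by rewrite mul0r.
  by rewrite (le_lt_trans st tpi) mul1r.
- by rewrite !(mul0r, mulr0).
- by rewrite q_at0 !(mul0r, mulr0); case: ifP.
Qed.

Let outerE f r : r \in `]0, pi[ -> measurable_fun setT f ->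
  outer f r = (\int[leb]_(t in `[r, pi]) (p t * f t)%:E)%E.
Proof.
rewrite in_itv/= => /andP[r0 rpi] mf; rewrite -integral_itv_bndo_bndc; last first.
  by apply/measurable_EFinP; apply: measurable_funTS; exact: measurable_funM.
rewrite [RHS]integral_mkcond; apply: eq_integral => t _.
rewrite patchE mem_setE in_itv/= /below /cut in_itv/=.
have [rt|rt] := leP r t; last by rewrite mul0r.
by rewrite (lt_le_trans r0 rt)/=; case: ifP; rewrite mul1r ?mul0r.
Qed.

Let inner_u t : t \in `]0, pi[ -> inner (cut u) t = (V t)%:E.
Proof.
move=> /[dup] tpi; rewrite in_itv/= => /andP[t0 t1]; rewrite innerE//.
rewrite /V /Rintegral fineK; last first.
  by apply: integrable_fin_num => //; apply: integrable_vsin; rewrite in_itv/= !ltW.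
apply: eq_integral => s; rewrite inE/= in_itv/= => /andP[s0 st]; congr EFin.
have spi : s < pi by exact: le_lt_trans st _.
move: s0; rewrite le_eqVlt => /predU1P[<-|s0].
  by rewrite q_at0 sin0 mulr0 mul0r.
by rewrite cutE ?q_u ?in_itv/= ?s0 ?spi ?(ltW spi) ?(ltW s0).
Qed.

Let outer_cut_V r : r \in `]0, pi[ -> outer (cut V) r = (c * u r)%:E.
Proof.
move=> rpi; rewrite -outer_V// -outerE//; apply: eq_integral => t _.
by rewrite /cut; case: ifP => //; rewrite !mul0r.
Qed.

Let cut_ltW f : {in `]0, pi[, forall r, 0 < f r} -> forall r, 0 <= cut f r.
Proof. by move=> f0; apply: cut_ge0 => r /f0/ltW. Qed.

Let schur_inner h : measurable_fun setT h -> (forall s, 0 <= h s) ->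
  (\int[leb]_t ((cut p t)%:E * (inner h t * inner h t)) <=
   c%:E * \int[leb]_s (cut q s * h s ^+ 2)%:E)%E.
Proof.
move=> mh h0.
apply: (@schur_test _ _ _ _ _ leb leb (cut p) (cut V) (cut q) (cut u) h
  (fun t s => below s t) c) => //.
- exact: measurable_cut.
- exact: measurable_cut.
- exact: measurable_cut.
- exact: measurable_cut.
- by apply: cut_ltW => r /p_gt0.
- by apply: cut_ltW => r /q_gt0.
- exact: ltW.
- by apply: cut_ltW => r /V_gt0.
- by apply: cut_ltW => r /u_gt0.
- by move=> t /cut_neq0 tpi; rewrite cutE ?V_gt0.
- by move=> s /cut_neq0 spi; rewrite cutE ?u_gt0.
- by move=> t /cut_neq0 tpi; rewrite cutE// -inner_u.
- by move=> s /cut_neq0 spi; rewrite cutE// -outer_cut_V.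
Qed.

Let schur_outer f : measurable_fun setT f -> (forall t, 0 <= f t) ->
  (\int[leb]_r ((cut q r)%:E * (outer f r * outer f r)) <=
   c%:E * \int[leb]_t (cut p t * f t ^+ 2)%:E)%E.
Proof.
move=> mf f0.
apply: (@schur_test _ _ _ _ _ leb leb (cut q) (fun r => c * cut u r) (cut p) (cut V) f
  (fun r t => below r t) c) => //.
- exact: measurable_cut.
- by apply: measurable_funM => //; exact: measurable_cut.
- exact: measurable_cut.
- exact: measurable_cut.
- by apply: cut_ltW => r /q_gt0.
- by apply: cut_ltW => r /p_gt0.
- exact: ltW.
- by move=> r; rewrite mulr_ge0 ?(ltW c_gt0)//; apply: cut_ltW => ? /u_gt0.
- by apply: cut_ltW => r /V_gt0.
- by move=> s /cut_neq0 spi; rewrite cutE// mulr_gt0// u_gt0.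
- by move=> t /cut_neq0 tpi; rewrite cutE ?V_gt0.
- by move=> s /cut_neq0 spi; rewrite cutE// -outer_cut_V.
- move=> t /cut_neq0 tpi; rewrite cutE// EFinM -inner_u// /inner.
  under eq_integral => s _ do rewrite (mulrCA (cut q s) c) (mulrCA _ c) EFinM.
  rewrite ge0_integralZl_EFin//.
  + move=> s _; rewrite lee_fin !mulr_ge0//.
      by apply: cut_ltW => ? /q_gt0.
    by apply: cut_ltW => ? /u_gt0.
  + apply/measurable_EFinP; apply: measurable_funM.
      exact: (measurableT_comp mbelow (pair2_measurable t)).
    by apply: measurable_funM; exact: measurable_cut.
  + exact: ltW.
Qed.

Let measurable_inner h : measurable_fun setT h -> (forall s, 0 <= h s) ->
  measurable_fun setT (inner h).
Proof.
move=> mh h0.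
have mwt : measurable_fun setT (fun s => cut q s * h s).
  by apply: measurable_funM => //; exact: measurable_cut.
apply: (measurable_fun_fubini_tonelli_F (m2 := leb)
    (fun z => (below z.2 z.1 * (cut q z.2 * h z.2))%:E)).
  apply/measurable_EFinP; apply: measurable_funM => //.
  exact: (measurableT_comp mwt measurable_snd).
move=> z; rewrite lee_fin !mulr_ge0//.
by apply: cut_ltW => ? /q_gt0.
Qed.

Let measurable_outer f : measurable_fun setT f -> (forall s, 0 <= f s) ->
  measurable_fun setT (outer f).
Proof.
move=> mf f0.
have mwt : measurable_fun setT (fun s => cut p s * f s).
  by apply: measurable_funM => //; exact: measurable_cut.
apply: (measurable_fun_fubini_tonelli_F (m2 := leb)
    (fun z => (below z.1 z.2 * (cut p z.2 * f z.2))%:E)).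
  apply/measurable_EFinP; apply: measurable_funM => //.
  exact: (measurableT_comp mwt measurable_snd).
move=> z; rewrite lee_fin !mulr_ge0//.
by apply: cut_ltW => ? /p_gt0.
Qed.

Let inner_ge0 h t : (forall s, 0 <= h s) -> (0 <= inner h t)%E.
Proof.
move=> h0; apply: integral_ge0 => s _; rewrite lee_fin !mulr_ge0//.
by apply: cut_ltW => ? /q_gt0.
Qed.

Let outer_ge0 f r : (forall s, 0 <= f s) -> (0 <= outer f r)%E.
Proof.
move=> f0; apply: integral_ge0 => s _; rewrite lee_fin !mulr_ge0//.
by apply: cut_ltW => ? /p_gt0.
Qed.

Lemma abs_Rintegral_le (D : set (measurableTypeR R)) f :
  measurable D -> measurable_fun D f ->
  ((`|\int[leb]_(x in D) f x|)%:E <= \int[leb]_(x in D) (`|f x|)%:E)%E.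
Proof.
move=> mD mf; have mE : measurable_fun D (EFin \o f) by exact/measurable_EFinP.
apply: le_trans (le_abse_integral leb mD mE).
rewrite /Rintegral; case: (\int[leb]_(x in D) _)%E => [x| |] //=.
  by rewrite normr0 leey.
by rewrite normr0 leey.
Qed.

Let integral_mu_cut f : measurable_fun setT f -> (forall s, 0 <= f s) ->
  (\int[mu]_x (f x)%:E = \int[leb]_s (cut q s * f s)%:E)%E.
Proof.
move=> mf f0; rewrite ge0_integral_mu//; last exact/measurable_EFinP.
rewrite -integral_itv_bndo_bndc; last first.
  by apply: emeasurable_funM; apply/measurable_EFinP; apply: measurable_funTS.
rewrite integral_mkcond; apply: eq_integral => s _.
rewrite patchE mem_setE in_itv/= /cut in_itv/= -EFinM mulrC.
have [s0|s0|<-] := ltrgtP 0 s.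
- by case: ifP => //; rewrite mul0r.
- by rewrite mul0r.
- by rewrite -/(q 0) q_at0 pi_gt0 !mul0r.
Qed.

Let primitive_le g t : measurable_fun setT g -> t \in `]0, pi[ ->
  ((`|primitive_mu g t|)%:E <= inner (fun s => `|g s|%R) t)%E.
Proof.
move=> mg /[dup] tpi; rewrite in_itv/= => /andP[t0 t1]; rewrite innerE//.
apply: le_trans (abs_Rintegral_le _ _) _ => //.
  by apply: measurable_funTS; apply: measurable_funM => //; exact: mq.
rewrite le_eqVlt; apply/orP; left; apply/eqP; apply: eq_integral => s.
rewrite inE/= in_itv/= => /andP[s0 st]; rewrite normrM ger0_norm//.
by apply: density_L_ge0; rewrite /= in_itv/= s0 (le_trans st)// ltW.
Qed.

Let green_le g r : measurable_fun setT g -> r \in `]0, pi[ ->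
  ((`|green g r|)%:E <= outer (fun t => `|primitive_mu g t|%R) r)%E.
Proof.
move=> mg /[dup] rpi; rewrite in_itv/= => /andP[r0 r1].
have mP := @measurable_primitive_mu R M n g mg.
rewrite outerE//; last exact: measurableT_comp.
apply: le_trans (abs_Rintegral_le _ _) _ => //.
  by apply: measurable_funTS; apply: measurable_funM => //; exact: mp.
rewrite le_eqVlt; apply/orP; left; apply/eqP; apply: eq_integral => t.
rewrite inE/= in_itv/= => /andP[rt tp]; rewrite normrM ger0_norm//.
rewrite divr_ge0 ?sqr_ge0// dvol_ge0//= in_itv/= tp andbT ltW//.
exact: lt_le_trans rt.
Qed.

Let sqr_le_ereal (x : R) (y : \bar R) : ((`|x|)%:E <= y -> (x ^+ 2)%:E <= y * y)%E.
Proof.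
move=> xy; rewrite -(real_normK (num_real x)) expr2 EFinM.
by apply: lee_pmul; rewrite ?lee_fin.
Qed.

Let primitive_bound g : measurable_fun setT g ->
  (\int[leb]_t (cut p t * `|primitive_mu g t| ^+ 2)%:E <=
   c%:E * \int[leb]_s (cut q s * `|g s| ^+ 2)%:E)%E.
Proof.
move=> mg; have mP := @measurable_primitive_mu R M n g mg.
have mag : measurable_fun setT (fun s => `|g s|) by exact: measurableT_comp.
apply: le_trans (schur_inner mag (fun s => normr_ge0 (g s))).
have cp0 : forall r, 0 <= cut p r by apply: cut_ltW => ? /p_gt0.
apply: ge0_le_integral => //.
- by move=> t _; rewrite lee_fin mulr_ge0// sqr_ge0.
- apply/measurable_EFinP; apply: measurable_funM; first exact: measurable_cut.
  by apply: measurable_funX; exact: measurableT_comp.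
- apply: emeasurable_funM; first by apply/measurable_EFinP; exact: measurable_cut.
  by apply: emeasurable_funM; exact: measurable_inner.
- move=> t _; rewrite EFinM; have [->|/cut_neq0 tpi] := eqVneq (cut p t) 0.
    by rewrite !mul0e.
  apply: lee_wpmul2l; rewrite ?lee_fin// real_normK ?num_real//.
  by apply: sqr_le_ereal; exact: primitive_le.
Qed.

Let green_bound2 g : measurable_fun setT g ->
  (\int[leb]_r (cut q r * `|green g r| ^+ 2)%:E <=
   c%:E * (c%:E * \int[leb]_s (cut q s * `|g s| ^+ 2)%:E))%E.
Proof.
move=> mg; have mP := @measurable_primitive_mu R M n g mg.
have mG := @measurable_green R M n g mg.
have maP : measurable_fun setT (fun s => `|primitive_mu g s|) by exact: measurableT_comp.
have c0 : (0 <= c%:E)%E by rewrite lee_fin ltW.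
apply: le_trans (lee_wpmul2l c0 (primitive_bound mg)).
apply: le_trans (schur_outer maP (fun s => normr_ge0 (primitive_mu g s))).
have cq0 : forall r, 0 <= cut q r by apply: cut_ltW => ? /q_gt0.
apply: ge0_le_integral => //.
- by move=> t _; rewrite lee_fin mulr_ge0// sqr_ge0.
- apply/measurable_EFinP; apply: measurable_funM; first exact: measurable_cut.
  by apply: measurable_funX; exact: measurableT_comp.
- apply: emeasurable_funM; first by apply/measurable_EFinP; exact: measurable_cut.
  by apply: emeasurable_funM; exact: measurable_outer.
- move=> t _; rewrite EFinM; have [->|/cut_neq0 tpi] := eqVneq (cut q t) 0.
    by rewrite !mul0e.
  apply: lee_wpmul2l; rewrite ?lee_fin// real_normK ?num_real//.
  by apply: sqr_le_ereal; exact: green_le.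
Qed.

Let integral_sqr_mu g : measurable_fun setT g ->
  (\int[mu]_x (g x ^+ 2)%:E = \int[leb]_s (cut q s * `|g s| ^+ 2)%:E)%E.
Proof.
move=> mg; rewrite integral_mu_cut; last 2 first.
- exact: measurable_funX.
- by move=> s; exact: sqr_ge0.
by apply: eq_integral => s _; rewrite real_normK ?num_real.
Qed.

Lemma green_L2 g : g \in Lfun mu 2%:E -> green g \in Lfun mu 2%:E.
Proof.
move=> gL; have mg := L2_measurable gL; have mG := @measurable_green R M n g mg.
apply/in_L2P; split => //; rewrite integral_sqr_mu//.
apply: le_lt_trans (green_bound2 mg) _.
rewrite -integral_sqr_mu// -EFin_L2norm_sq// -!EFinM; exact: ltry.
Qed.

Lemma green_bounded g : g \in Lfun mu 2%:E ->
  L2norm mu (green g) <= - (1 / eigval 1) * L2norm mu g.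
Proof.
move=> gL; have mg := L2_measurable gL; have mG := @measurable_green R M n g mg.
have c0 := ltW c_gt0.
rewrite -/c -(@ler_pXn2r _ 2) ?nnegrE ?mulr_ge0 ?L2norm_ge0//.
rewrite -lee_fin EFin_L2norm_sq ?green_L2// integral_sqr_mu//.
apply: le_trans (green_bound2 mg) _.
rewrite -integral_sqr_mu// -EFin_L2norm_sq// -!EFinM lee_fin.
by rewrite exprMn expr2 mulrA.
Qed.

Let ae_sub2 (P Q S : R -> Prop) : (forall t, P t -> Q t -> S t) ->
  {ae leb, forall t, P t} -> {ae leb, forall t, Q t} -> {ae leb, forall t, S t}.
Proof.
exact: (@filterS2 (measurableTypeR R) _ (ae_filter_ringOfSetsType leb)).
Qed.

Let ae_sub (P Q : R -> Prop) : (forall t, P t -> Q t) ->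
  {ae leb, forall t, P t} -> {ae leb, forall t, Q t}.
Proof.
exact: (@filterS (measurableTypeR R) _ (ae_filter_ringOfSetsType leb)).
Qed.

Let fin_ae (a : R -> R) (T : R -> \bar R) :
    measurable_fun setT a -> measurable_fun setT T -> (forall t, 0 <= a t) ->
    (forall t, (0 <= T t)%E) ->
    (\int[leb]_t ((a t)%:E * (T t * T t)) < +oo)%E ->
  {ae leb, forall t, 0 < a t -> (T t < +oo)%E}.
Proof.
move=> ma mT a0 T0 fin.
have ig : leb.-integrable setT (fun t => (a t)%:E * (T t * T t))%E.
  apply/integrableP; split.
    apply: emeasurable_funM; first exact/measurable_EFinP.
    exact: emeasurable_funM.
  by under eq_integral do rewrite gee0_abs ?mule_ge0 ?lee_fin//.
have := integrable_ae measurableT ig; apply: filterS => t /(_ I) fin_t at0.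
rewrite ltey; apply/eqP => Ty; move: fin_t.
by rewrite Ty mulyy gt0_muley ?lte_fin.
Qed.

Let integral_q_lty g : g \in Lfun mu 2%:E ->
  (\int[leb]_s (cut q s * `|g s| ^+ 2)%:E < +oo)%E.
Proof.
move=> gL; have mg := L2_measurable gL; rewrite -integral_sqr_mu//.
by have [] := (in_L2P mu g).1 gL.
Qed.

Let inner_fin g : g \in Lfun mu 2%:E ->
  {ae leb, forall t, t \in `]0, pi[ -> (inner (fun s => `|g s|%R) t < +oo)%E}.
Proof.
move=> gL; have mg := L2_measurable gL.
have mag : measurable_fun setT (fun s => `|g s|) by exact: measurableT_comp.
have fin := schur_inner mag (fun s => normr_ge0 (g s)).
have c0 : (0 <= c%:E)%E by rewrite lee_fin ltW.
have {}fin := le_lt_trans fin (lte_mul_pinfty c0 isT (integral_q_lty gL)).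
have H := @fin_ae (cut p) (inner (fun s => `|g s|)) (measurable_cut mp)
  (measurable_inner mag (fun s => normr_ge0 _)) (cut_ltW p_gt0)
  (fun t => inner_ge0 t (fun s => normr_ge0 _)) fin.
by apply: ae_sub H => t Ht tpi; apply: Ht; rewrite cutE// p_gt0.
Qed.

Let outer_fin g : g \in Lfun mu 2%:E ->
  {ae leb, forall r, r \in `]0, pi[ ->
    (outer (fun t => `|primitive_mu g t|%R) r < +oo)%E}.
Proof.
move=> gL; have mg := L2_measurable gL.
have mP := @measurable_primitive_mu R M n g mg.
have maP : measurable_fun setT (fun s => `|primitive_mu g s|) by exact: measurableT_comp.
have c0 : (0 <= c%:E)%E by rewrite lee_fin ltW.
have fin := schur_outer maP (fun s => normr_ge0 (primitive_mu g s)).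
have fin1 := le_lt_trans (primitive_bound mg)
  (lte_mul_pinfty c0 isT (integral_q_lty gL)).
have {}fin := le_lt_trans fin (lte_mul_pinfty c0 isT fin1).
have H := @fin_ae (cut q) (outer (fun s => `|primitive_mu g s|)) (measurable_cut mq)
  (measurable_outer maP (fun s => normr_ge0 _)) (cut_ltW q_gt0)
  (fun t => outer_ge0 t (fun s => normr_ge0 _)) fin.
by apply: ae_sub H => t Ht tpi; apply: Ht; rewrite cutE// q_gt0.
Qed.

Let integrable_q g t : measurable_fun setT g -> t \in `]0, pi[ ->
  (inner (fun s => `|g s|%R) t < +oo)%E ->
  leb.-integrable `[0, t] (EFin \o (fun s => q s * g s)).
Proof.
move=> mg /[dup] tpi; rewrite in_itv/= => /andP[t0 t1] fin.
apply/integrableP; split.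
  by apply/measurable_EFinP; apply: measurable_funTS; exact: measurable_funM.
move: fin; rewrite innerE//; apply: le_lt_trans.
rewrite le_eqVlt; apply/orP; left; apply/eqP; apply: eq_integral => s.
rewrite inE/= in_itv/= => /andP[s0 st]; rewrite normrM ger0_norm//.
by apply: density_L_ge0; rewrite /= in_itv/= s0 (le_trans st)// ltW.
Qed.

Let integrable_p f r : measurable_fun setT f -> r \in `]0, pi[ ->
  (outer (fun s => `|f s|%R) r < +oo)%E ->
  leb.-integrable `[r, pi] (EFin \o (fun t => p t * f t)).
Proof.
move=> mf /[dup] rpi; rewrite in_itv/= => /andP[r0 r1] fin.
apply/integrableP; split.
  by apply/measurable_EFinP; apply: measurable_funTS; exact: measurable_funM.
move: fin; rewrite outerE//; last exact: measurableT_comp.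
apply: le_lt_trans; rewrite le_eqVlt; apply/orP; left; apply/eqP.
apply: eq_integral => t.
rewrite inE/= in_itv/= => /andP[rt tp]; rewrite normrM ger0_norm//.
rewrite divr_ge0 ?sqr_ge0// dvol_ge0//= in_itv/= tp andbT ltW//.
exact: lt_le_trans rt.
Qed.

Let Rintegral_lin (D : set (measurableTypeR R)) f g (k : R) : measurable D ->
  leb.-integrable D (EFin \o f) -> leb.-integrable D (EFin \o g) ->
  \int[leb]_(x in D) (f x + k * g x) =
  \int[leb]_(x in D) f x + k * \int[leb]_(x in D) g x.
Proof.
move=> mD fi gi; rewrite RintegralD//; first by rewrite RintegralZl.
have := integrableZl mD k gi.
by congr integrable; apply/funext => x; rewrite /= EFinM.
Qed.

Let primitive_lin f g (k : R) : f \in Lfun mu 2%:E -> g \in Lfun mu 2%:E ->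
  {ae leb, forall t, t \in `]0, pi[ ->
    primitive_mu (fun s => f s + k * g s) t = primitive_mu f t + k * primitive_mu g t}.
Proof.
move=> fL gL; have mf := L2_measurable fL; have mg := L2_measurable gL.
apply: ae_sub2 (inner_fin fL) (inner_fin gL) => t ft gt tpi.
rewrite -Rintegral_lin//.
- by apply: eq_Rintegral => s _; ring.
- exact: integrable_q (ft tpi).
- exact: integrable_q (gt tpi).
Qed.

(** The bounds above show that the integrals converge almost everywhere, which
    is all one can expect: [green g r] may diverge at [r = 0]. *)
Lemma green_lin f g (k : R) : f \in Lfun mu 2%:E -> g \in Lfun mu 2%:E ->
  green (fun x => f x + k * g x) = (fun x => green f x + k * green g x) %[ae mu].
Proof.
move=> fL gL; have mf := L2_measurable fL; have mg := L2_measurable gL.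
have mPf := @measurable_primitive_mu R M n f mf.
have mPg := @measurable_primitive_mu R M n g mg.
have mfg : measurable_fun setT (fun x => f x + k * g x).
  by apply: measurable_funD => //; exact: measurable_funM.
have mPfg := @measurable_primitive_mu R M n _ mfg.
apply: ae_mu.
have in_oo : {ae leb, forall r : R, `[0, pi]%classic r -> r \in `]0, pi[}.
  exact: ae_segment.
apply: ae_sub2 (outer_fin gL) (ae_sub2 (fun _ => @conj _ _) (outer_fin fL) in_oo).
move=> r gr [fr r_oo] rpi _.
have {}r_oo := r_oo rpi.
rewrite -Rintegral_lin//; last 2 first.
- exact: integrable_p (fr r_oo).
- exact: integrable_p (gr r_oo).
congr fine; apply: ae_eq_integral => //.
- by apply/measurable_EFinP; apply: measurable_funTS; exact: measurable_funM.
- apply/measurable_EFinP; apply: measurable_funTS; apply: measurable_funD.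
    exact: measurable_funM.
  by apply: measurable_funM => //; exact: measurable_funM.
apply: ae_sub2 (primitive_lin k fL gL) in_oo => t Ht t_oo.
rewrite /= in_itv/= => /andP[rt tpi].
have {}t_oo : t \in `]0, pi[.
  apply: t_oo; rewrite /= in_itv/= tpi andbT.
  by move: rpi; rewrite /= in_itv/= => /andP[r0 _]; exact: le_trans rt.
transitivity (p t * primitive_mu (fun s => f s + k * g s) t)%:E => //.
transitivity (p t * primitive_mu f t + k * (p t * primitive_mu g t))%:E => //.
by rewrite Ht//; congr EFin; ring.
Qed.

End green_bounded.

Section final.
Variables (R : realType) (M : crossSpace) (n : nat).
Hypothesis nM : valid_dim M n.
Local Notation mu := (@inv_measure_L R M n).
Local Notation green := (@green R M n).
Local Notation psi := (@link_phi R M n).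
Local Notation eigval := (@eigval R M n).

Lemma green_link_phi_ae k : (1 <= k)%N ->
  green (psi k) = (fun x => - (1 / eigval k) * psi k x) %[ae mu].
Proof.
move=> k1.
apply: ae_mu; apply: ae_segment => r; rewrite in_itv/= => /andP[r0 rpi] _.
by rewrite green_link_phi// ltW.
Qed.

Lemma green_normalized k : (1 <= k)%N ->
  green (fun x => psi k x / L2norm mu (psi k)) =
  (fun x => - (1 / eigval k) * (psi k x / L2norm mu (psi k))) %[ae mu].
Proof.
move=> k1; have pL := link_phi_L2 R nM k1.
(* [psi + (1 / norm - 1) * psi] has the form required by linearity. *)
have := green_lin nM ((L2norm mu (psi k))^-1 - 1) pL pL.
rewrite (_ : (fun x => psi k x + _ * psi k x) =
    fun x => psi k x / L2norm mu (psi k)); last first.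
  by apply/funext => x; ring.
move=> H; apply: (@filterS2 (measurableTypeR R) _ (ae_filter_ringOfSetsType mu)) H
  (green_link_phi_ae k1) => x /= e1 e2 _.
by rewrite e1// e2//; ring.
Qed.

End final.

Theorem proposition24 (R : realType) (M : crossSpace) (n : nat)
    (n_ge2 : (2 <= n)%N) (nM : valid_dim M n) :
  let mu := @inv_measure_L R M n in
  let tmu := @inv_measure_Delta R M n in
  let G := @green R M n in
  let phi := @phi R M n in
  let Lphi := @link_phi R M n in
  let lambda := @eigval R M n in
  let Lphi_normalized := fun k r => Lphi k r / L2norm mu (Lphi k) in
  [/\ orthogonal_system mu (fun k => Lphi k.+1) /\
      complete_system mu (fun k => Lphi k.+1),
      hilbert_basis mu (fun k => Lphi_normalized k.+1) /\
      (forall k, (1 <= k)%N ->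
        eigenfunction mu G (- 1 / lambda k) (Lphi_normalized k)),
      forall k, (1 <= k)%N ->
        L2norm mu (Lphi k) ^+ 2 = - (1 / lambda k) * L2norm tmu (phi k) ^+ 2
    & forall (g : R -> R) (m : nat), g \in Lfun mu 2%:E ->
        L2_cvg mu
          (fun N r => \sum_(1 <= k < N.+1)
             (- (1 / lambda k)) ^+ m * (1 / L2norm mu (Lphi k) ^+ 2)
               * Lphi k r * L2dot mu (Lphi k) g)
          (iter m G g)].
Proof.
move=> mu tmu G phi Lphi lambda Lphi_normalized.
have oe := orthogonal_link_phi R nM; have ce := @complete_link_phi R M n nM.
have hb := hilbert_basis_normalized oe ce.
split=> [//||k k1|g m gL]; first split=> [//|k k1].
- have [k' kE] : exists k', k = k'.+1 by case: k k1 => // k' _; exists k'.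
  have nL : Lphi_normalized k \in Lfun mu 2%:E.
    by rewrite kE; exact: (normalized_L2 oe k').
  have n1 : L2norm mu (Lphi_normalized k) = 1.
    by rewrite kE; exact: (normalized_norm oe k').
  split=> //.
    move=> n0; have := L2norm_ae nL (L2_0 mu) n0.
    by rewrite L2norm0 n1 => /eqP; rewrite oner_eq0.
  by have := green_normalized R nM k1; rewrite mulN1r div1r.
- exact: L2norm_link_phi.
have [GL cvg_G] := spectral_expansion oe ce (green_L2 nM) (green_bounded nM)
  (fun f h a fL hL => green_lin nM a fL hL)
  (fun k => green_link_phi_ae R nM (ltn0Sn k)) m gL.
split=> //; set S := (X in X @ _).
have -> : S = (fun N => (L2norm mu (fun x => \sum_(k < N) (- (1 / lambda k.+1)) ^+ m *
    (L2dot mu (Lphi k.+1) g / L2norm mu (Lphi k.+1) ^+ 2) * Lphi k.+1 x -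
    iter m G g x))%:E).
  apply/funext => N; rewrite -L2normE; last first.
    apply: L2_sub => //; apply: (@L2_sum _ _ _ mu N (fun k => (- (1 / lambda k.+1)) ^+ m *
      (L2dot mu (Lphi k.+1) g / L2norm mu (Lphi k.+1) ^+ 2)) (fun k => Lphi k.+1)).
    by case: oe.
  congr (Lnorm _ _ (EFin \o _)); apply/funext => x; congr (_ - _).
  by rewrite big_add1 big_mkord; apply: eq_bigr => k _; ring.
by apply: cvg_EFin => //; exact: nearW.
Qed.
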